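(* Suppose the reduced-Hessian, controllability, upper-boundedness and compactness assumptions stated in the context hold for the SQP iterates, with a search direction $(\tilde\Delta z^\tau,\tilde\Delta\lambda^\tau)$ satisfying $$\|(\tilde\Delta z^\tau-\Delta z^\tau,\tilde\Delta\lambda^\tau-\Delta\lambda^\tau)\|\le\delta\,\|(\Delta z^\tau,\Delta\lambda^\tau)\|,\qquad\delta\in(0,1).$$ If $$\eta_1\ge\frac{17}{\eta_2\gamma_G},\qquad\eta_2\le\frac{\gamma_{RH}}{12\Upsilon^2},\qquad\delta\le\frac{\eta_2\gamma_G}{9\eta_1\Upsilon^2},$$ then $$\begin{pmatrix}\nabla_z\mathcal{L}_\eta^\tau\\ \nabla_\lambda\mathcal{L}_\eta^\tau\end{pmatrix}^T\begin{pmatrix}\tilde\Delta z^\tau\\ \tilde\Delta\lambda^\tau\end{pmatrix}\le-\frac{\eta_2}{2}\left\|\begin{pmatrix}\nabla_z\mathcal{L}^\tau\\ \nabla_\lambda\mathcal{L}^\tau\end{pmatrix}\right\|^2 .$$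
   Context: $[n]=\{0,\dots,n\}$. Consider the nonlinear dynamic program $\min\sum_{k=0}^{N-1}g_k(x_k,u_k)+g_N(x_N)$ s.t. $x_{k+1}=f_k(x_k,u_k)$, $k\in[N-1]$, $x_0=\bar x_0$, with $x_k\in\mathbb{R}^{n_x}$, $u_k\in\mathbb{R}^{n_u}$. Write $z_k=(x_k;u_k)$ ($k<N$), $z_N=x_N$, $z=(z_0;\dots;z_N)$, $f(z)=(x_0-\bar x_0;x_1-f_0(z_0);\dots;x_N-f_{N-1}(z_{N-1}))$, $g(z)$ the objective, $\lambda=(\lambda_0;\dots;\lambda_N)$ with $\lambda_k\in\mathbb{R}^{n_x}$, $\mathcal{L}(z,\lambda)=g(z)+\lambda^Tf(z)$. $G(z)$ is the Jacobian of $f$; $A_k(z_k),B_k(z_k)$ are the Jacobians of $f_k$ w.r.t. $x_k,u_k$. $H(z,\lambda)=\nabla_z^2\mathcal{L}=\mathrm{diag}(H_0,\dots,H_N)$, where $H_k$ depends on $(z_k,\lambda_{k+1})$ for $k<N$ and $H_N$ on $z_N$ only. Merit function (exact augmented Lagrangian), $\eta=(\eta_1,\eta_2)$, $\eta_1,\eta_2>0$: $\mathcal{L}_\eta(z,\lambda)=\mathcal{L}(z,\lambda)+\frac{\eta_1}{2}\|\nabla_\lambda\mathcal{L}(z,\lambda)\|^2+\frac{\eta_2}{2}\|\nabla_z\mathcal{L}(z,\lambda)\|^2$. SQP iterates: superscript $\tau$ denotes evaluation at $(z^\tau,\lambda^\tau)$. $\hat H^\tau=\mathrm{diag}(\hat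 H_0^\tau,\dots,\hat H_N^\tau)$ is a symmetric modification of $H^\tau$ with the same block diagonal structure. The exact Newton direction $(\Delta z^\tau,\Delta\lambda^\tau)$ solves $\begin{pmatrix}\hat H^\tau&(G^\tau)^T\\ G^\tau&0\end{pmatrix}\begin{pmatrix}\Delta z^\tau\\ \Delta\lambda^\tau\end{pmatrix}=-\begin{pmatrix}\nabla_z\mathcal{L}^\tau\\ \nabla_\lambda\mathcal{L}^\tau\end{pmatrix}$; an approximate direction $(\tilde\Delta z^\tau,\tilde\Delta\lambda^\tau)$ is used and $(z^{\tau+1},\lambda^{\tau+1})=(z^\tau,\lambda^\tau)+\alpha_\tau(\tilde\Delta z^\tau,\tilde\Delta\lambda^\tau)$. Assumptions (constants independent of $\tau$). Reduced Hessian: for every $\tau$, if $Z^\tau$ has orthonormal columns spanning $\{w:G^\tau w=0\}$, then $(Z^\tau)^T\hat H^\tau Z^\tau\succeq\gamma_{RH}I$, $\gamma_{RH}>0$. Controllability: with $\Xi_{k,s}=(B_{k+s-1}\ \ A_{k+s-1}B_{k+s-2}\ \cdots\ (A_{k+s-1}\cdots A_{k+1})B_k)$, there are $\gamma_C>0$ and an integer $t>0$ such that for every $\tau$ and $k\in[N-t]$ there is $t_k^\tau\in\{1,\dots,t\}$ with $\Xi^\tau_{k,t_k^\tau}(\Xi^\tau_{k,t_k^\tau})^T\succeq\gamma_C I$. Upper boundedness: $\max\{\|\hat H_k^\tau\|,\|A_k^\tau\|,\|B_k^\tau\|\}\le\Upsilon_{upper}$ for all $k,\tau$. Compactness: there is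 a compact set $\mathcal{Z}\times\Lambda$, $\mathcal{Z}=\mathcal{Z}_0\times\dots\times\mathcal{Z}_N$, $\Lambda=\Lambda_0\times\dots\times\Lambda_N$, with $(z^\tau+\alpha\tilde\Delta z^\tau,\lambda^\tau+\alpha\tilde\Delta\lambda^\tau)\in\mathcal{Z}\times\Lambda$ for all $\tau\ge0$, $\alpha\in[0,1]$; $g_k,f_k$ are thrice continuously differentiable; and $\max\{\sup_{\mathcal{Z}_k\times\Lambda_{k+1}}\|H_k\|,\sup_{\mathcal{Z}_k}\|A_k\|,\sup_{\mathcal{Z}_k}\|B_k\|\}\le\Upsilon_{upper}$ for all $k$ (same constant; for $k=N$: $\sup_{\mathcal{Z}_N}\|H_N\|\le\Upsilon_{upper}$). Here $\Upsilon_{upper}>1$. Constants: $\gamma_G=\Big(\frac{\gamma_C}{\gamma_C+\Upsilon_{upper}^{t+1}/(\Upsilon_{upper}-1)}\Big)^2\frac{\min\{1,\gamma_C\}}{(1+\Upsilon_{upper})^{2t}}$; $\Upsilon_{HG}>0$ is a constant with $\max\{\sup_{\mathcal{Z}\times\Lambda}\|H\|,\sup_{\mathcal{Z}}\|G\|\}\le\Upsilon_{HG}$; $\Upsilon_{KKT}>0$ is a constant with $\Big\|\begin{pmatrix}\hat H^\tau&(G^\tau)^T\\ G^\tau&0\end{pmatrix}^{-1}\Big\|\le\Upsilon_{KKT}$ for all $\tau$ (both exist under the assumptions); $\Upsilon=\max\{\Upsilon_{upper},\Upsilon_{KKT},\Upsilon_{HG}\}$. *)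

(* Defs.v *)
From HB Require Import structures.
From mathcomp Require Import all_boot all_order all_algebra.
From mathcomp Require Import all_classical all_reals all_analysis.

Set Implicit Arguments.
Unset Strict Implicit.
Unset Printing Implicit Defensive.

Import Order.TTheory GRing.Theory Num.Theory.
Import numFieldNormedType.Exports.

Local Open Scope classical_set_scope.
Local Open Scope ring_scope.

Section Euclidean.
Context {R : realType}.

(* The library norm on matrices is the sup norm, hence these two norms. *)
Definition enorm {n} (v : 'cV[R]_n) : R := Num.sqrt (\sum_i v i 0 ^+ 2).

Definition opnorm {m n} (M : 'M[R]_(m, n)) : R :=
  sup [set enorm (M *m v) | v in [set v : 'cV[R]_n | enorm v <= 1]].

Definition psdmx {n} (M : 'M[R]_n) : Prop :=
  M^T = M /\ forall v : 'cV[R]_n, 0 <= (v^T *m M *m v) 0 0.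

Definition loewner_ge {n} (M P : 'M[R]_n) : Prop := psdmx (M - P).

End Euclidean.

Section Calculus.
Context {R : realType}.

Definition grad {n} (phi : 'cV[R]_n -> R) (p : 'cV[R]_n) : 'cV[R]_n :=
  \col_i 'D_(delta_mx i 0) phi p.

(* Row i, column j holds the j-th partial derivative of the i-th component;
   the library's jacobian acts on row vectors and is the transpose. *)
Definition jac {m n} (f : 'cV[R]_n -> 'cV[R]_m) (p : 'cV[R]_n) : 'M[R]_(m, n) :=
  \matrix_(i, j) ('D_(delta_mx j 0) f p) i 0.

Definition hess {n} (phi : 'cV[R]_n -> R) (p : 'cV[R]_n) : 'M[R]_n :=
  jac (grad phi) p.

Fixpoint cont_diff (m : nat) {V W : normedModType R} (f : V -> W) : Prop :=
  if m is m'.+1 then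
    (forall p, differentiable f p) /\ (forall v, cont_diff m' ('D_v f))
  else continuous f.

End Calculus.

(* Each stage vector z_k = (x_k; u_k) is a single column vector. *)
Record ocp (R : realType) (N nx nu : nat) := Ocp {
  dyn : 'I_N -> 'cV[R]_(nx + nu) -> 'cV[R]_nx;
  cost : 'I_N -> 'cV[R]_(nx + nu) -> R;
  costN : 'cV[R]_nx -> R;
  xinit : 'cV[R]_nx }.

Section DynamicProgram.
Context {R : realType} {N nx nu : nat}.

Definition zdim : nat := (\sum_(k < N) (nx + nu) + nx)%N.
Definition ldim : nat := (\sum_(k < N.+1) nx)%N.

Definition stage (z : 'cV[R]_zdim) (k : 'I_N) : 'cV[R]_(nx + nu) :=
  submxcol (usubmx z) k.

Definition stageN (z : 'cV[R]_zdim) : 'cV[R]_nx := dsubmx z.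

Definition state (z : 'cV[R]_zdim) (k : 'I_N.+1) : 'cV[R]_nx :=
  if unlift ord_max k is Some j then usubmx (stage z j) else stageN z.

Definition mult (l : 'cV[R]_ldim) (k : 'I_N.+1) : 'cV[R]_nx := submxcol l k.

Variable P : ocp R N nx nu.

Definition objective (z : 'cV[R]_zdim) : R :=
  \sum_(k < N) cost P k (stage z k) + costN P (stageN z).

(* The index lift ord0 j is j + 1. *)
Definition constr (z : 'cV[R]_zdim) : 'cV[R]_ldim :=
  \mxcol_(k < N.+1)
    (if unlift ord0 k is Some j
     then state z (lift ord0 j) - dyn P j (stage z j)
     else state z ord0 - xinit P).

Definition lagrangian (z : 'cV[R]_zdim) (l : 'cV[R]_ldim) : R :=
  objective z + (l^T *m constr z) 0 0.

Definition grad_z (z : 'cV[R]_zdim) (l : 'cV[R]_ldim) : 'cV[R]_zdim :=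
  grad (fun z' => lagrangian z' l) z.

Definition grad_l (z : 'cV[R]_zdim) (l : 'cV[R]_ldim) : 'cV[R]_ldim :=
  grad (lagrangian z) l.

Definition kkt_residual (z : 'cV[R]_zdim) (l : 'cV[R]_ldim) :
    'cV[R]_(zdim + ldim) := col_mx (grad_z z l) (grad_l z l).

Definition Hmx (z : 'cV[R]_zdim) (l : 'cV[R]_ldim) : 'M[R]_zdim :=
  hess (fun z' => lagrangian z' l) z.

Definition Gmx (z : 'cV[R]_zdim) : 'M[R]_(ldim, zdim) := jac constr z.

Definition Amx (k : 'I_N) (y : 'cV[R]_(nx + nu)) : 'M[R]_nx :=
  jac (fun x => dyn P k (col_mx x (dsubmx y))) (usubmx y).

Definition Bmx (k : 'I_N) (y : 'cV[R]_(nx + nu)) : 'M[R]_(nx, nu) :=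
  jac (fun u => dyn P k (col_mx (usubmx y) u)) (dsubmx y).

(* The diagonal blocks of Hmx: the terms of the Lagrangian that are nonlinear
   in z_k are g_k(z_k) - lambda_{k+1}^T f_k(z_k), and g_N(z_N) for k = N. *)
Definition Hblock (k : 'I_N) (y : 'cV[R]_(nx + nu)) (mu : 'cV[R]_nx) :
    'M[R]_(nx + nu) :=
  hess (fun y' => cost P k y' - (mu^T *m dyn P k y') 0 0) y.

Definition HblockN (x : 'cV[R]_nx) : 'M[R]_nx := hess (costN P) x.

Definition merit (eta1 eta2 : R) (z : 'cV[R]_zdim) (l : 'cV[R]_ldim) : R :=
  lagrangian z l + eta1 / 2 * enorm (grad_l z l) ^+ 2
                 + eta2 / 2 * enorm (grad_z z l) ^+ 2.

Definition merit_grad (eta1 eta2 : R) (z : 'cV[R]_zdim) (l : 'cV[R]_ldim) :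
    'cV[R]_(zdim + ldim) :=
  col_mx (grad (fun z' => merit eta1 eta2 z' l) z)
         (grad (merit eta1 eta2 z) l).

Definition thrice_cont_diff : Prop :=
  [/\ forall k, cont_diff 3 (cost P k), forall k, cont_diff 3 (dyn P k)
    & cont_diff 3 (costN P)].

Definition hhat_mx (Hh : 'I_N -> 'M[R]_(nx + nu)) (HhN : 'M[R]_nx) :
    'M[R]_zdim := block_mx (\mxdiag_(k < N) Hh k) 0 0 HhN.

Definition kkt_mx (Hh : 'I_N -> 'M[R]_(nx + nu)) (HhN : 'M[R]_nx)
    (z : 'cV[R]_zdim) : 'M[R]_(zdim + ldim) :=
  block_mx (hhat_mx Hh HhN) (Gmx z)^T (Gmx z) 0.

Definition orthonormal_basis_ker {m n d} (M : 'M[R]_(m, n)) (Z : 'M[R]_(n, d)) :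
    Prop :=
  Z^T *m Z = 1%:M /\
  forall w : 'cV[R]_n, M *m w = 0 <-> exists y : 'cV[R]_d, w = Z *m y.

Definition reduced_hessian (gRH : R) (Hh : 'I_N -> 'M[R]_(nx + nu))
    (HhN : 'M[R]_nx) (z : 'cV[R]_zdim) : Prop :=
  forall d (Z : 'M[R]_(zdim, d)), orthonormal_basis_ker (Gmx z) Z ->
    loewner_ge (Z^T *m hhat_mx Hh HhN *m Z) gRH%:M.

(* Extension by 0 of a family indexed by 0..N-1 to all naturals; the value 0
   is never used below, where all indices are k, ..., k + s - 1 with k + s <= N. *)
Definition ext0 {V : zmodType} (F : 'I_N -> V) (i : nat) : V :=
  if insub i is Some j then F j else 0.

(* transition A m j = A_{m+j-1} ... A_m *)
Fixpoint transition (A : nat -> 'M[R]_nx) (m j : nat) : 'M[R]_nx :=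
  if j is j'.+1 then A (m + j')%N *m transition A m j' else 1%:M.

(* Block j is A_{k+s-1} ... A_{k+s-j} B_{k+s-1-j}, for j = 0, ..., s-1. *)
Definition ctrl_mx (A : nat -> 'M[R]_nx) (B : nat -> 'M[R]_(nx, nu))
    (k s : nat) : 'M[R]_(nx, \sum_(j < s) nu) :=
  \mxrow_(j < s) (transition A (k + s - j) j *m B (k + s - j.+1)%N).

Definition controllable (gC : R) (t : nat) (z : 'cV[R]_zdim) : Prop :=
  forall k : nat, (k + t <= N)%N ->
    exists tk : nat, (1 <= tk <= t)%N /\
      let Xi := ctrl_mx (ext0 (fun i => Amx i (stage z i)))
                        (ext0 (fun i => Bmx i (stage z i))) k tk in
      loewner_ge (Xi *m Xi^T) gC%:M.

Definition upper_bounded (Uupper : R) (Hh : 'I_N -> 'M[R]_(nx + nu))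
    (HhN : 'M[R]_nx) (z : 'cV[R]_zdim) : Prop :=
  (forall k : 'I_N, [/\ opnorm (Hh k) <= Uupper,
     opnorm (Amx k (stage z k)) <= Uupper
   & opnorm (Bmx k (stage z k)) <= Uupper]) /\
  opnorm HhN <= Uupper.

Definition primal_box (Zs : 'I_N -> set 'cV[R]_(nx + nu))
    (ZN : set 'cV[R]_nx) : set 'cV[R]_zdim :=
  [set z | (forall k, Zs k (stage z k)) /\ ZN (stageN z)].

Definition dual_box (Ls : 'I_N.+1 -> set 'cV[R]_nx) : set 'cV[R]_ldim :=
  [set l | forall k, Ls k (mult l k)].

Definition box_bounded (Uupper : R) (Zs : 'I_N -> set 'cV[R]_(nx + nu))
    (ZN : set 'cV[R]_nx) (Ls : 'I_N.+1 -> set 'cV[R]_nx) : Prop :=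
  (forall (k : 'I_N) y, Zs k y ->
     [/\ forall mu, Ls (lift ord0 k) mu -> opnorm (Hblock k y mu) <= Uupper,
         opnorm (Amx k y) <= Uupper & opnorm (Bmx k y) <= Uupper]) /\
  (forall x, ZN x -> opnorm (HblockN x) <= Uupper).

End DynamicProgram.

Arguments zdim : clear implicits.
Arguments ldim : clear implicits.

Definition gammaG {R : realType} (gC Uupper : R) (t : nat) : R :=
  (gC / (gC + Uupper ^+ t.+1 / (Uupper - 1))) ^+ 2 *
  (Num.min 1 gC / (1 + Uupper) ^+ (2 * t)%N).

(* Main.v *)
From HB Require Import structures.
Require Import Defs.
From mathcomp Require Import all_boot all_order all_algebra.
From mathcomp Require Import all_classical all_reals all_analysis.
From mathcomp Require Import ring lra zify.

Import Order.TTheory GRing.Theory Num.Theory.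
Import numFieldNormedType.Exports.

Local Open Scope classical_set_scope.
Local Open Scope ring_scope.

(** Write [a] and [c] for the gradients of the Lagrangian in z and in lambda,
    [G] for the constraint Jacobian, [H] and [Hh] for the Hessian of the
    Lagrangian and its modification, [dz] and [dl] for the exact Newton
    direction, and [U] for a common bound on the operator norms.

    Along the exact direction the two Newton equations turn the derivative of
    the merit function into

      - dz^T Hh dz + 2 c^T dl - eta1 |c|^2 - eta2 |a|^2 + eta2 a^T (H - Hh) dz.

    Split [dz] into a part in the kernel of [G], where the reduced Hessian is
    positive definite, and the least-norm solution of [G v = - c], whose norm
    is controlled by [c]. The only dangerous term is then [2 c^T dl]: the second
    block of the direction is known through [G^T dl = - (a + Hh dz)] alone, so
    it is bounded only if [G^T] is coercive. Given [|G^T l|^2 >= g |l|^2], the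
    term is absorbed by a fraction of [eta2 |a|^2], by the curvature, and by
    [eta1 |c|^2]. This leaves a decrease of at least 53/100 eta2 |(a, c)|^2
    ([descent_exact]); replacing the exact direction by the approximate one
    costs at most 3/100 eta2 |(a, c)|^2 ([descent_error]).

    The coercivity ([Gmx_coercive]) is proved with [g = gammaG / 4]; the
    constants 17, 12 and 9 leave room for the factor 4. The blocks of [G^T l]
    are the defects of the backward recursion [l_k = A_k^T l_(k+1) + p_k] and
    the values [- B_k^T l_(k+1)]. On a controllable window [k, k+s) the adjoint
    of the controllability matrix maps [l_(k+s)] to a combination of these
    data, which determines [l_(k+s)] and, by unrolling the recursion, [l_k].
    Used with the full window, this loses a factor of about U^(2s) / sqrt gC,
    which is too much when gC is large. But the last [r] inputs of the window
    contribute at most U^2 + ... + U^(2r) to the Gramian; as long as this sum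
    is at most gC / 2, the first [s - r] inputs account for the other half.
    They therefore control the window ending at k+s-r, at a loss of U^r
    ([reach_shorten]), and the defects are amplified over a shorter window.
    Taking [r] maximal for that condition brings in a second factor
    1 / sqrt gC, and the estimate matches [gammaG]. Each [l_k] is thus bounded
    by a short convolution of the data, and Young's inequality sums these
    bounds over k with a constant independent of the horizon. *)

(** * Euclidean norm and operator norm *)

Definition dotv {R : realType} {n} (u v : 'cV[R]_n) : R := (u^T *m v) 0 0.

Section Euclid.
Set Implicit Arguments.
Unset Strict Implicit.
Context {R : realType}.

Lemma dotvE n (u v : 'cV[R]_n) : dotv u v = \sum_i u i 0 * v i 0.
Proof. by rewrite /dotv mxE; apply: eq_bigr => i _; rewrite mxE. Qed.

Lemma dotvC n (u v : 'cV[R]_n) : dotv u v = dotv v u.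
Proof. by rewrite !dotvE; apply: eq_bigr => i _; rewrite mulrC. Qed.

Lemma dotvDl n (u v w : 'cV[R]_n) : dotv (u + v) w = dotv u w + dotv v w.
Proof. by rewrite /dotv linearD /= mulmxDl mxE. Qed.

Lemma dotvDr n (u v w : 'cV[R]_n) : dotv w (u + v) = dotv w u + dotv w v.
Proof. by rewrite /dotv mulmxDr mxE. Qed.

Lemma dotvNl n (u w : 'cV[R]_n) : dotv (- u) w = - dotv u w.
Proof. by rewrite /dotv linearN /= mulNmx mxE. Qed.

Lemma dotvNr n (u w : 'cV[R]_n) : dotv w (- u) = - dotv w u.
Proof. by rewrite /dotv mulmxN mxE. Qed.

Lemma dotvBl n (u v w : 'cV[R]_n) : dotv (u - v) w = dotv u w - dotv v w.
Proof. by rewrite dotvDl dotvNl. Qed.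

Lemma dotvBr n (u v w : 'cV[R]_n) : dotv w (u - v) = dotv w u - dotv w v.
Proof. by rewrite dotvDr dotvNr. Qed.

Lemma dotvZl n a (u w : 'cV[R]_n) : dotv (a *: u) w = a * dotv u w.
Proof. by rewrite /dotv linearZ /= -scalemxAl mxE. Qed.

Lemma dotvZr n a (u w : 'cV[R]_n) : dotv w (a *: u) = a * dotv w u.
Proof. by rewrite dotvC dotvZl dotvC. Qed.

Lemma dotv0l n (w : 'cV[R]_n) : dotv 0 w = 0.
Proof. by rewrite /dotv trmx0 mul0mx mxE. Qed.

Lemma dotv0r n (w : 'cV[R]_n) : dotv w 0 = 0.
Proof. by rewrite dotvC dotv0l. Qed.

Lemma dotv_mull m n (M : 'M[R]_(m, n)) u v : dotv (M *m u) v = dotv u (M^T *m v).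
Proof. by rewrite /dotv trmx_mul mulmxA. Qed.

Lemma dotv_mulr m n (M : 'M[R]_(m, n)) u v : dotv u (M *m v) = dotv (M^T *m u) v.
Proof. by rewrite dotvC dotv_mull dotvC. Qed.

Lemma dotv_col_mx m n (u u' : 'cV[R]_m) (v v' : 'cV[R]_n) :
  dotv (col_mx u v) (col_mx u' v') = dotv u u' + dotv v v'.
Proof. by rewrite /dotv tr_col_mx mul_row_col mxE. Qed.

Lemma dotv_mxcol p (p_ : 'I_p -> nat) (u v : 'cV[R]_(\sum_i p_ i)) :
  dotv u v = \sum_i dotv (submxcol u i) (submxcol v i).
Proof.
rewrite -{1}(submxcolK u) -{1}(submxcolK v) /dotv tr_mxcol mul_mxrow_mxcol.
by rewrite summxE.
Qed.

Lemma enorm_sq n (v : 'cV[R]_n) : enorm v ^+ 2 = dotv v v.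
Proof.
rewrite /enorm sqr_sqrtr; last by apply: sumr_ge0 => i _; exact: sqr_ge0.
by rewrite dotvE; apply: eq_bigr => i _; rewrite expr2.
Qed.

Lemma dotv_ge0 n (v : 'cV[R]_n) : 0 <= dotv v v.
Proof. by rewrite -enorm_sq sqr_ge0. Qed.

Lemma enorm_ge0 n (v : 'cV[R]_n) : 0 <= enorm v.
Proof. exact: sqrtr_ge0. Qed.

Lemma enorm_eq0 n (v : 'cV[R]_n) : enorm v = 0 -> v = 0.
Proof.
move=> v0; have: dotv v v = 0 by rewrite -enorm_sq v0 expr0n.
rewrite dotvE => /eqP; rewrite psumr_eq0; last first.
  by move=> i _; rewrite -expr2 sqr_ge0.
move=> /allP h; apply/colP => i; rewrite mxE.
have := h i (mem_index_enum _); rewrite implyTb -expr2 sqrf_eq0.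
by move/eqP.
Qed.

Lemma enorm0 n : enorm (0 : 'cV[R]_n) = 0.
Proof. by apply/eqP; rewrite -sqrf_eq0 enorm_sq dotv0l. Qed.

Lemma enormN n (v : 'cV[R]_n) : enorm (- v) = enorm v.
Proof.
apply: (pexpIrn (n := 2)) => //; rewrite ?nnegrE ?enorm_ge0 //.
by rewrite !enorm_sq dotvNl dotvNr opprK.
Qed.

Lemma enormZ n a (v : 'cV[R]_n) : enorm (a *: v) = `|a| * enorm v.
Proof.
apply: (pexpIrn (n := 2)) => //; rewrite ?nnegrE ?mulr_ge0 ?enorm_ge0 //.
by rewrite exprMn real_normK ?num_real // !enorm_sq dotvZl dotvZr mulrA expr2.
Qed.

Lemma le_enorm n (v : 'cV[R]_n) (C : R) :
  0 <= C -> dotv v v <= C ^+ 2 -> enorm v <= C.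
Proof. by move=> C0; rewrite -enorm_sq ler_pXn2r // nnegrE ?enorm_ge0. Qed.

Lemma cauchy_schwarz n (u v : 'cV[R]_n) : dotv u v <= enorm u * enorm v.
Proof.
have [v0|v0] := eqVneq (enorm v) 0.
  by rewrite v0 mulr0 (enorm_eq0 v0) dotv0r.
have vp : 0 < enorm v by rewrite lt_def v0 enorm_ge0.
have := dotv_ge0 (enorm v *: u - enorm u *: v).
rewrite dotvBl !dotvBr !(dotvZl, dotvZr) -!enorm_sq (dotvC v u) => h.
have [u0|u0] := eqVneq (enorm u) 0.
  by rewrite u0 mul0r (enorm_eq0 u0) dotv0l.
have up : 0 < enorm u by rewrite lt_def u0 enorm_ge0.
have uv := mulr_gt0 up vp.
rewrite -(ler_pM2l uv).
nra.
Qed.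

Lemma cauchy_schwarz_abs n (u v : 'cV[R]_n) :
  `|dotv u v| <= enorm u * enorm v.
Proof.
rewrite ler_norml cauchy_schwarz andbT lerNl -dotvNl.
by apply: le_trans (cauchy_schwarz _ _) _; rewrite enormN.
Qed.

Lemma enormD n (u v : 'cV[R]_n) : enorm (u + v) <= enorm u + enorm v.
Proof.
apply: le_enorm; first by rewrite addr_ge0 ?enorm_ge0.
rewrite dotvDl !dotvDr (dotvC v u) sqrrD !enorm_sq.
by have := cauchy_schwarz u v; lra.
Qed.

Lemma enorm_col_mx m n (u : 'cV[R]_m) (v : 'cV[R]_n) :
  enorm (col_mx u v) ^+ 2 = enorm u ^+ 2 + enorm v ^+ 2.
Proof. by rewrite !enorm_sq dotv_col_mx. Qed.

(** The supremum defining the operator norm is a genuine bound: by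
    Cauchy-Schwarz on each row, the Frobenius norm is an upper bound. *)
Lemma opnorm_has_sup m n (M : 'M[R]_(m, n)) :
  has_sup [set enorm (M *m v) | v in [set v : 'cV[R]_n | enorm v <= 1]].
Proof.
split; first by exists (enorm (M *m 0)), 0 => //=; rewrite enorm0.
pose C := \sum_i enorm (row i M)^T ^+ 2.
have C0 : 0 <= C by apply: sumr_ge0 => i _; exact: sqr_ge0.
exists (Num.sqrt C) => _ [v /= v1 <-].
apply: le_enorm; first exact: sqrtr_ge0.
rewrite sqr_sqrtr // dotvE /C; apply: ler_sum => i _.
have -> : (M *m v) i 0 = dotv (row i M)^T v.
  by rewrite dotvE mxE; apply: eq_bigr => j _; rewrite !mxE.
rewrite -expr2 -(real_normK (num_real (dotv _ _))) ler_pXn2r ?nnegrE ?enorm_ge0 //.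
apply: le_trans (cauchy_schwarz_abs _ _) _.
by apply: ler_piMr => //; exact: enorm_ge0.
Qed.

Lemma enorm_mul_le m n (M : 'M[R]_(m, n)) (C : R) (v : 'cV[R]_n) :
  opnorm M <= C -> enorm (M *m v) <= C * enorm v.
Proof.
move=> MC; have [v0|v0] := eqVneq (enorm v) 0.
  by rewrite (enorm_eq0 v0) mulmx0 !enorm0 mulr0.
have vp : 0 < enorm v by rewrite lt_def v0 enorm_ge0.
rewrite -ler_pdivrMr //; apply: le_trans MC.
apply: ub_le_sup; first by have [] := opnorm_has_sup M.
have ev : enorm ((enorm v)^-1 *: v) = 1.
  by rewrite enormZ ger0_norm ?invr_ge0 ?enorm_ge0 // mulVf.
exists ((enorm v)^-1 *: v) => /=; first by rewrite ev.
by rewrite -scalemxAr enormZ ger0_norm ?invr_ge0 ?enorm_ge0 // mulrC.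
Qed.

Lemma enorm_trmul_le m n (M : 'M[R]_(m, n)) (C : R) (v : 'cV[R]_m) :
  0 <= C -> opnorm M <= C -> enorm (M^T *m v) <= C * enorm v.
Proof.
move=> C0 MC; have [v0|v0] := eqVneq (enorm (M^T *m v)) 0.
  by rewrite v0 mulr_ge0 ?enorm_ge0.
have vp : 0 < enorm (M^T *m v) by rewrite lt_def v0 enorm_ge0.
rewrite -(ler_pM2l vp) -expr2 enorm_sq dotv_mull trmxK.
apply: le_trans (cauchy_schwarz _ _) _.
rewrite mulrC mulrA ler_wpM2r ?enorm_ge0 // mulrC.
exact: enorm_mul_le.
Qed.

End Euclid.

(** * Differentiability and directional derivatives *)

Section Calculus.
Set Implicit Arguments.
Unset Strict Implicit.
Context {R : realType}.

(** In finite dimension a linear map is a finite sum of coordinates times fixed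
    vectors, which gives its continuity as well. *)
Lemma differentiable_linfun n (W : normedModType R) (L : 'cV[R]_n -> W) p :
  linear L -> differentiable L p.
Proof.
move=> lL.
pose L' : {linear 'cV[R]_n -> W} := HB.pack L (GRing.isLinear.Build _ _ _ _ _ lL).
have -> : L = \sum_(i < n) (fun x : 'cV[R]_n => x i 0 *: L (delta_mx i 0)).
  apply/funext => x; rewrite fct_sumE [in LHS](matrix_sum_delta x).
  rewrite -[L]/(L' : _ -> _) linear_sum; apply: eq_bigr => i _.
  by rewrite big_ord1 linearZ.
apply: differentiable_sum => i; apply: differentiableZl.
exact: differentiable_coord.
Qed.

Lemma derive_linfun n (W : normedModType R) (L : 'cV[R]_n -> W) p v :
  linear L -> 'D_v L p = L v.
Proof.
move=> lL.
pose L' : {linear 'cV[R]_n -> W} := HB.pack L (GRing.isLinear.Build _ _ _ _ _ lL).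
have dL q : differentiable L q by exact: differentiable_linfun.
have cL : continuous L' by move=> q; exact: differentiable_continuous (dL q).
by rewrite deriveE // -[LHS]/(_ v) (diff_lin p cL).
Qed.

(** The two difference quotients are the same function of the step, because
    [L] maps the line through [p] along [v] to the line through [L p]. *)
Lemma derive_precomp_affine (U V W : normedModType R) (L L0 : U -> V)
    (f : V -> W) p v :
  (forall h, L (h *: v + p) = h *: L0 v + L p) ->
  'D_v (f \o L) p = 'D_(L0 v) f (L p).
Proof.
move=> lL; rewrite /derive.
suff -> : (fun h => h^-1 *: ((f \o L \o shift p) (h *: v) - (f \o L) p)) =
    (fun h => h^-1 *: ((f \o shift (L p)) (h *: L0 v) - f (L p))) by [].
by apply/funext => h /=; rewrite lL.
Qed.

Lemma derive_precomp n (V W : normedModType R) (L : 'cV[R]_n -> V)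
    (f : V -> W) p v :
  linear L -> 'D_v (f \o L) p = 'D_(L v) f (L p).
Proof. by move=> lL; apply: derive_precomp_affine => h; rewrite lL. Qed.

Lemma derive_postcomp m (V W : normedModType R) (L : 'cV[R]_m -> W)
    (f : V -> 'cV[R]_m) p v :
  linear L -> differentiable f p -> 'D_v (L \o f) p = L ('D_v f p).
Proof.
move=> lL df; have dL q : differentiable L q by exact: differentiable_linfun.
rewrite deriveE; last exact: differentiable_comp.
by rewrite diff_comp //= -deriveE // -deriveE // derive_linfun.
Qed.

(** The regularity that the gradient of the merit function calls for: the
    gradient of the Lagrangian enters it squared and has to be differentiable. *)
Definition twice_diff {V W : normedModType R} (f : V -> W) : Prop :=
  (forall p, differentiable f p) /\ (forall v p, differentiable ('D_v f) p).

Lemma cont_diff_twice (V W : normedModType R) (f : V -> W) :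
  cont_diff 3 f -> twice_diff f.
Proof. by move=> [df d2]; split => // v; have [] := d2 v. Qed.

Lemma twice_diff_lin n (W : normedModType R) (L : 'cV[R]_n -> W) :
  linear L -> twice_diff L.
Proof.
move=> lL; split=> [p|v p]; first exact: differentiable_linfun.
rewrite (_ : 'D_v L = cst (L v)) //.
by apply/funext => q; rewrite derive_linfun.
Qed.

Lemma twice_diff_cst (V W : normedModType R) (a : W) :
  twice_diff (cst a : V -> W).
Proof.
split=> [p|v p] //; rewrite (_ : 'D_v _ = cst 0) //.
by apply/funext => q; rewrite derive_cst.
Qed.

Lemma twice_diffD (V W : normedModType R) (f g : V -> W) :
  twice_diff f -> twice_diff g -> twice_diff (f + g).
Proof.
move=> [df d2f] [dg d2g]; split=> [p|v p]; first exact: differentiableD.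
rewrite (_ : 'D_v _ = 'D_v f + 'D_v g); first exact: differentiableD.
by apply/funext => q; rewrite deriveD //; exact: diff_derivable.
Qed.

Lemma twice_diffN (V W : normedModType R) (f : V -> W) :
  twice_diff f -> twice_diff (- f).
Proof.
move=> [df d2f]; split=> [p|v p]; first exact: differentiableN.
rewrite (_ : 'D_v _ = - 'D_v f); first exact: differentiableN.
by apply/funext => q; rewrite deriveN //; exact: diff_derivable.
Qed.

Lemma twice_diff_sum (V W : normedModType R) n (f : 'I_n -> V -> W) :
  (forall i, twice_diff (f i)) -> twice_diff (\sum_(i < n) f i).
Proof.
by move=> df; elim/big_ind : _ => // [|? ? ? ?]; [exact: twice_diff_cst|exact: twice_diffD].
Qed.

Lemma twice_diff_precomp n m (W : normedModType R)
    (L : 'cV[R]_n -> 'cV[R]_m) (f : 'cV[R]_m -> W) :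
  linear L -> twice_diff f -> twice_diff (f \o L).
Proof.
move=> lL [df d2f]; have dL q : differentiable L q by exact: differentiable_linfun.
split=> [p|v p]; first exact: differentiable_comp.
rewrite (_ : 'D_v _ = 'D_(L v) f \o L); first exact: differentiable_comp.
by apply/funext => q /=; rewrite derive_precomp.
Qed.

Lemma twice_diff_postcomp m (V W : normedModType R)
    (L : 'cV[R]_m -> W) (f : V -> 'cV[R]_m) :
  linear L -> twice_diff f -> twice_diff (L \o f).
Proof.
move=> lL [df d2f]; have dL q : differentiable L q by exact: differentiable_linfun.
split=> [p|v p]; first exact: differentiable_comp.
rewrite (_ : 'D_v _ = L \o 'D_v f); first exact: differentiable_comp.
by apply/funext => q /=; rewrite derive_postcomp.
Qed.

Lemma dotv_linr n (u : 'cV[R]_n) : linear (dotv u).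
Proof. by move=> a v w; rewrite dotvDr dotvZr. Qed.

(** Where [phi] is not differentiable, its partial derivatives need not determine
    the other directional derivatives. *)
Lemma dotv_grad n (phi : 'cV[R]_n -> R) p v :
  differentiable phi p -> dotv (grad phi p) v = 'D_v phi p.
Proof.
move=> dphi; rewrite deriveE // [in RHS](matrix_sum_delta v) linear_sum dotvE.
apply: eq_bigr => i _.
by rewrite big_ord1 linearZ /= mxE -deriveE // mulrC.
Qed.

Lemma mul_jac n m (f : 'cV[R]_n -> 'cV[R]_m) p v :
  differentiable f p -> jac f p *m v = 'D_v f p.
Proof.
move=> df; rewrite deriveE // [in RHS](matrix_sum_delta v) linear_sum.
apply/colP => i; rewrite mxE summxE; apply: eq_bigr => j _.
by rewrite big_ord1 linearZ /= !mxE -deriveE // mulrC.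
Qed.

Lemma differentiable_grad n (phi : 'cV[R]_n -> R) p :
  twice_diff phi -> differentiable (grad phi) p.
Proof.
move=> [_ d2].
have -> : grad phi =
    \sum_(i < n) (fun q => 'D_(delta_mx i 0) phi q *: (delta_mx i 0 : 'cV[R]_n)).
  apply/funext => q; rewrite fct_sumE [LHS]matrix_sum_delta.
  by apply: eq_bigr => i _; rewrite big_ord1 mxE.
by apply: differentiable_sum => i; apply: differentiableZl; exact: d2.
Qed.

Lemma enorm_sqE (V : normedModType R) n (f : V -> 'cV[R]_n) :
  (fun p => enorm (f p) ^+ 2) =
  \sum_(i < n) (fun p => f p i 0) * (fun p => f p i 0).
Proof.
by apply/funext => p; rewrite fct_sumE enorm_sq dotvE.
Qed.

Lemma coord_lin n (i : 'I_n) : linear (fun v : 'cV[R]_n => v i 0 : R).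
Proof. by move=> a u v; rewrite !mxE. Qed.

Lemma differentiable_enorm_sq (V : normedModType R) n (f : V -> 'cV[R]_n) p :
  differentiable f p -> differentiable (fun p => enorm (f p) ^+ 2) p.
Proof.
move=> df; rewrite enorm_sqE; apply: differentiable_sum => i.
have dfi : differentiable (fun p => f p i 0 : R) p.
  by apply: (@differentiable_comp _ _ _ _ f (fun v : 'cV[R]_n => v i 0 : R)) => //;
    exact: differentiable_coord.
exact: differentiableM.
Qed.

Lemma derive_enorm_sq (V : normedModType R) n (f : V -> 'cV[R]_n) p v :
  differentiable f p ->
  'D_v (fun p => enorm (f p) ^+ 2) p = 2 * dotv (f p) ('D_v f p).
Proof.
move=> df; have dfi (i : 'I_n) : differentiable (fun p => f p i 0 : R) p.
  by apply: (@differentiable_comp _ _ _ _ f (fun v : 'cV[R]_n => v i 0 : R)) => //;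
    exact: differentiable_coord.
rewrite enorm_sqE derive_sum; last first.
  by move=> i; apply: diff_derivable; exact: differentiableM.
rewrite dotvE mulr_sumr; apply: eq_bigr => i _.
rewrite deriveM; [|exact: diff_derivable..].
rewrite -/((fun v : 'cV[R]_n => v i 0 : R) \o f).
have -> : 'D_v (fun p => f p i 0 : R) p = 'D_v f p i 0.
  by have := @derive_postcomp _ _ _ _ f p v (@coord_lin n i) df.
by rewrite /GRing.scale /=; ring.
Qed.

End Calculus.

(** * Gradients of the Lagrangian and of the merit function, and the constraint Jacobian *)

Section Problem.
Set Implicit Arguments.
Unset Strict Implicit.
Context {R : realType} {N nx nu : nat}.
Variable P : ocp R N nx nu.
Notation zv := ('cV[R]_(zdim N nx nu)).
Notation lv := ('cV[R]_(ldim N nx)).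

Lemma stage_linear k : linear (fun z : zv => stage z k).
Proof. by move=> a u v; apply/matrixP => i j; rewrite !mxE. Qed.

Lemma stageN_linear : linear (@stageN R N nx nu).
Proof. by move=> a u v; apply/matrixP => i j; rewrite !mxE. Qed.

Lemma usub_linear m n : linear (@usubmx R m n 1).
Proof. by move=> a u v; apply/matrixP => i j; rewrite !mxE. Qed.

Lemma state_linear k : linear (fun z : zv => state z k).
Proof.
move=> a u v; rewrite /state; case: unlift => [j|]; last exact: stageN_linear.
by rewrite stage_linear usub_linear.
Qed.

Lemma mult_linear k : linear (fun l : lv => mult l k).
Proof. by move=> a u v; apply/matrixP => i j; rewrite !mxE. Qed.

Definition constr_block (k : 'I_N.+1) (z : zv) : 'cV[R]_nx :=
  if unlift ord0 k is Some j
  then state z (lift ord0 j) - dyn P j (stage z j)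
  else state z ord0 - xinit P.

Lemma mult_constr z k : mult (constr P z) k = constr_block k z.
Proof. by rewrite /mult /constr mxcolK. Qed.

(** Writing the constraint as a sum of such embeddings reduces its
    differentiability to that of its blocks. *)
Definition embed (k : 'I_N.+1) (x : 'cV[R]_nx) : lv :=
  \mxcol_(j < N.+1) (if j == k then x else 0).

Lemma embed_linear k : linear (embed k).
Proof.
move=> a u v; apply/mxcolP => j; rewrite submxcolD mxcolK.
have := mult_linear j a (embed k u) 0; rewrite addr0 /mult => ->.
by rewrite /embed !mxcolK submxcol0 addr0; case: eqP; rewrite ?scaler0 ?addr0.
Qed.

Lemma constr_sum : constr P = \sum_k (embed k \o constr_block k).
Proof.
apply/funext => z; rewrite fct_sumE; apply/mxcolP => j.
rewrite -[LHS]/(mult _ _) mult_constr submxcol_sum (bigD1 j) //= /embed mxcolK eqxx.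
by rewrite big1 ?addr0 // => i ij; rewrite mxcolK eq_sym (negPf ij).
Qed.

Hypothesis smooth : thrice_cont_diff P.

Lemma twice_diff_dyn k : twice_diff (dyn P k).
Proof. by case: smooth => _ h _; exact: cont_diff_twice. Qed.

Lemma twice_diff_objective : twice_diff (objective P).
Proof.
case: smooth => hc _ hN.
have -> : objective P =
    \sum_(k < N) (cost P k \o (fun z => stage z k)) + (costN P \o @stageN R N nx nu).
  by apply/funext => z; rewrite fctE fct_sumE.
apply: twice_diffD; last first.
  by apply: twice_diff_precomp; [exact: stageN_linear|exact: cont_diff_twice].
apply: twice_diff_sum => k.
by apply: twice_diff_precomp; [exact: stage_linear|exact: cont_diff_twice].
Qed.

Lemma twice_diff_constr_block k : twice_diff (constr_block k).
Proof.
rewrite /constr_block; case: unlift => [j|].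
  apply: (@twice_diffD _ _ _ (fun z => state z (lift ord0 j))
    (- (dyn P j \o (fun z : zv => stage z j)))).
    by apply: twice_diff_lin; exact: state_linear.
  apply/twice_diffN/twice_diff_precomp; first exact: stage_linear.
  exact: twice_diff_dyn.
apply: (@twice_diffD _ _ _ (fun z => state z ord0) (cst (- xinit P))).
  by apply: twice_diff_lin; exact: state_linear.
exact: twice_diff_cst.
Qed.

Lemma twice_diff_constr : twice_diff (constr P).
Proof.
rewrite constr_sum; apply: twice_diff_sum => k.
apply: twice_diff_postcomp; first exact: embed_linear.
exact: twice_diff_constr_block.
Qed.

Lemma lagrangianE l :
  (fun z => lagrangian P z l) = objective P + (dotv l \o constr P).
Proof. by apply/funext. Qed.

Lemma twice_diff_lagrangian l : twice_diff (fun z => lagrangian P z l).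
Proof.
rewrite lagrangianE; apply: twice_diffD; first exact: twice_diff_objective.
apply: twice_diff_postcomp; [exact: dotv_linr|exact: twice_diff_constr].
Qed.

Lemma mul_Gmx z w : Gmx P z *m w = 'D_w (constr P) z.
Proof. by apply: mul_jac; exact: (twice_diff_constr.1 z). Qed.

(** The Lagrangian is affine in the multiplier, so its gradient is the
    constraint residual. *)
Lemma grad_lE z l : grad_l P z l = constr P z.
Proof.
apply/colP => i; rewrite mxE.
have -> : lagrangian P z = cst (objective P z) + dotv (constr P z).
  by apply/funext => m; rewrite /lagrangian fctE dotvC.
have dl v : derivable (dotv (constr P z)) l v.
  by apply/diff_derivable/differentiable_linfun; exact: dotv_linr.
rewrite deriveD ?derive_cst ?add0r //.
rewrite derive_linfun; last exact: dotv_linr.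
rewrite dotvE (bigD1 i) //= big1 ?addr0; last first.
  by move=> j ji; rewrite [X in _ * X]mxE (negPf ji) mulr0.
by rewrite [X in _ * X]mxE !eqxx mulr1.
Qed.

Lemma grad_zE z l : grad_z P z l = grad (objective P) z + (Gmx P z)^T *m l.
Proof.
have dob q : differentiable (objective P) q by exact: twice_diff_objective.1.
have dc q : differentiable (constr P) q by exact: twice_diff_constr.1.
have dlc q : differentiable (dotv l \o constr P) q.
  apply: differentiable_comp => //; apply: differentiable_linfun; exact: dotv_linr.
apply/colP => i; rewrite /grad_z lagrangianE !mxE deriveD; [|exact: diff_derivable..].
congr (_ + _); rewrite derive_postcomp //; last exact: dotv_linr.
rewrite -mul_Gmx -colE dotvE; apply: eq_bigr => j _.
by rewrite [X in _ * X]mxE [X in _ = X * _]mxE mulrC.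
Qed.

Lemma mul_Hmx z l w : Hmx P z l *m w = 'D_w (fun z => grad_z P z l) z.
Proof. by apply: mul_jac; apply: differentiable_grad; exact: twice_diff_lagrangian. Qed.

Lemma merit_zE e1 e2 l : (fun z => merit P e1 e2 z l) =
  (fun z => lagrangian P z l) +
  (e1 / 2) *: (fun z => enorm (constr P z) ^+ 2) +
  (e2 / 2) *: (fun z => enorm (grad_z P z l) ^+ 2).
Proof. by apply/funext => z; rewrite /merit grad_lE. Qed.

(** The chain rule along [w]: the squared norms contribute the residual and the
    gradient paired with their own derivatives, [G w] and [H w]. *)
Lemma derive_merit_z e1 e2 z l w :
  dotv (grad (fun z => merit P e1 e2 z l) z) w =
  dotv (grad_z P z l) w + e1 * dotv (constr P z) (Gmx P z *m w)
    + e2 * dotv (grad_z P z l) (Hmx P z l *m w).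
Proof.
have dL : differentiable (fun z => lagrangian P z l) z.
  exact: (twice_diff_lagrangian l).1.
have dc : differentiable (constr P) z by exact: twice_diff_constr.1.
have dg : differentiable (fun z => grad_z P z l) z.
  by apply: differentiable_grad; exact: twice_diff_lagrangian.
have dc2 := differentiable_enorm_sq dc.
have dg2 := differentiable_enorm_sq dg.
rewrite dotv_grad; last first.
  rewrite merit_zE; apply: differentiableD; [apply: differentiableD => //|];
  exact: differentiableZ.
rewrite merit_zE deriveD; first last.
- by apply: diff_derivable; exact: differentiableZ.
- by apply: diff_derivable; apply: differentiableD => //; exact: differentiableZ.
rewrite deriveD; first last.
- by apply: diff_derivable; exact: differentiableZ.
- exact: diff_derivable.
rewrite !deriveZ; [|exact: diff_derivable..].
rewrite !derive_enorm_sq // -mul_Gmx -mul_Hmx -dotv_grad // -/(grad_z P z l).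
by rewrite /GRing.scale /=; field.
Qed.

Lemma merit_lE e1 e2 z : merit P e1 e2 z =
  lagrangian P z + cst (e1 / 2 * enorm (constr P z) ^+ 2)
  + (e2 / 2) *: (fun l => enorm (grad_z P z l) ^+ 2).
Proof. by apply/funext => l; rewrite /merit grad_lE. Qed.

(** The gradient in z is affine in the multiplier, with linear part the
    transposed Jacobian. *)
Lemma derive_merit_l e1 e2 z l w :
  dotv (grad (merit P e1 e2 z) l) w =
  dotv (constr P z) w + e2 * dotv (grad_z P z l) ((Gmx P z)^T *m w).
Proof.
have dL : differentiable (lagrangian P z) l.
  have -> : lagrangian P z = cst (objective P z) + dotv (constr P z).
    by apply/funext => m; rewrite /lagrangian fctE dotvC.
  apply: differentiableD => //.
  by apply: differentiable_linfun; exact: dotv_linr.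
have gE : (fun l => grad_z P z l) =
    cst (grad (objective P) z) + (mulmx (Gmx P z)^T : lv -> zv).
  by apply/funext => m; rewrite grad_zE.
have lG : linear (mulmx (Gmx P z)^T : lv -> zv).
  by move=> a u v; rewrite mulmxDr -scalemxAr.
have dG : differentiable (mulmx (Gmx P z)^T : lv -> zv) l.
  exact: differentiable_linfun.
have dg : differentiable (fun l => grad_z P z l) l.
  by rewrite gE; apply: differentiableD.
have dg2 := differentiable_enorm_sq dg.
rewrite dotv_grad; last first.
  rewrite merit_lE; apply: differentiableD; [apply: differentiableD => //|].
  exact: differentiableZ.
rewrite merit_lE deriveD; first last.
- by apply: diff_derivable; exact: differentiableZ.
- by apply: diff_derivable; apply: differentiableD.
rewrite deriveD; [|exact: diff_derivable..].
rewrite derive_cst deriveZ; last exact: diff_derivable.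
rewrite derive_enorm_sq // -dotv_grad // -/(grad_l P z l) grad_lE.
have -> : 'D_w (fun l => grad_z P z l) l = (Gmx P z)^T *m w.
  rewrite gE deriveD; [|exact: diff_derivable..].
  by rewrite derive_cst add0r derive_linfun.
by rewrite /GRing.scale /=; field.
Qed.

(** The Jacobians [Amx] and [Bmx] are taken with the other half of the stage
    vector fixed; differentiability makes them add up to the full derivative. *)
Lemma dyn_split (k : 'I_N) y v :
  'D_v (dyn P k) y = Amx P k y *m usubmx v + Bmx P k y *m dsubmx v.
Proof.
have dd q : differentiable (dyn P k) q by exact: (twice_diff_dyn k).1.
have lu : linear (fun x : 'cV[R]_nx => col_mx x (0 : 'cV[R]_nu)).
  by move=> a u w; rewrite scale_col_mx add_col_mx scaler0 addr0.
have ld : linear (fun x : 'cV[R]_nu => col_mx (0 : 'cV[R]_nx) x).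
  by move=> a u w; rewrite scale_col_mx add_col_mx scaler0 addr0.
have dcu p : differentiable (fun x : 'cV[R]_nx => col_mx x (dsubmx y)) p.
  have -> : (fun x : 'cV[R]_nx => col_mx x (dsubmx y)) =
      (fun x => col_mx x 0) + cst (col_mx 0 (dsubmx y)).
    by apply/funext => x; rewrite fctE add_col_mx addr0 add0r.
  by apply: differentiableD => //; exact: differentiable_linfun.
have dcd p : differentiable (fun x : 'cV[R]_nu => col_mx (usubmx y) x) p.
  have -> : (fun x : 'cV[R]_nu => col_mx (usubmx y) x) =
      (fun x => col_mx 0 x) + cst (col_mx (usubmx y) 0).
    by apply/funext => x; rewrite fctE add_col_mx addr0 add0r.
  by apply: differentiableD => //; exact: differentiable_linfun.
rewrite /Amx /Bmx !mul_jac; first last.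
- by apply: (@differentiable_comp _ _ _ _ _ (dyn P k)).
- by apply: (@differentiable_comp _ _ _ _ _ (dyn P k)).
rewrite (@derive_precomp_affine _ _ _ _ _ (fun x => col_mx x 0) (dyn P k)); last first.
  by move=> h; rewrite scale_col_mx add_col_mx scaler0 add0r.
rewrite (@derive_precomp_affine _ _ _ _ _ (fun x => col_mx 0 x) (dyn P k)); last first.
  by move=> h; rewrite scale_col_mx add_col_mx scaler0 add0r.
rewrite vsubmxK !deriveE // -linearD add_col_mx addr0 add0r vsubmxK //.
Qed.

(** This lemma and the next give the block bidiagonal form of the constraint
    Jacobian, on which the backward recursion for the multipliers rests. *)
Lemma mult_mul_Gmx0 z w : mult (Gmx P z *m w) ord0 = state w ord0.
Proof.
have dc q : differentiable (constr P) q by exact: twice_diff_constr.1.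
rewrite mul_Gmx -(derive_postcomp w (mult_linear ord0) (dc z)).
have -> : (fun l => mult l ord0) \o constr P =
    (fun z => state z ord0) + cst (- xinit P).
  by apply/funext => q /=; rewrite mult_constr /constr_block unlift_none.
rewrite deriveD //; last first.
  by apply/diff_derivable/differentiable_linfun; exact: state_linear.
by rewrite derive_cst addr0 derive_linfun //; exact: state_linear.
Qed.

Lemma mult_mul_Gmx z w (j : 'I_N) : mult (Gmx P z *m w) (lift ord0 j) =
  state w (lift ord0 j) - (Amx P j (stage z j) *m usubmx (stage w j)
     + Bmx P j (stage z j) *m dsubmx (stage w j)).
Proof.
have dc q : differentiable (constr P) q by exact: twice_diff_constr.1.
rewrite mul_Gmx -(derive_postcomp w (mult_linear (lift ord0 j)) (dc z)).
have -> : (fun l => mult l (lift ord0 j)) \o constr P =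
    (fun z => state z (lift ord0 j)) - (dyn P j \o (fun z => stage z j)).
  by apply/funext => q /=; rewrite mult_constr /constr_block liftK.
have ds : differentiable (fun z : zv => state z (lift ord0 j)) z.
  by apply/differentiable_linfun; exact: state_linear.
have dd : differentiable (dyn P j \o (fun z : zv => stage z j)) z.
  apply: differentiable_comp; last exact: (twice_diff_dyn j).1.
  by apply: differentiable_linfun; exact: stage_linear.
rewrite deriveB; [|exact: diff_derivable..].
rewrite derive_linfun; last exact: state_linear.
by rewrite derive_precomp ?dyn_split //; exact: stage_linear.
Qed.

End Problem.

(** * Two inequalities for sums *)

Section Aux.
Set Implicit Arguments.
Unset Strict Implicit.
Context {R : realType}.

(** Minkowski's inequality in the plane; it makes [reach] subadditive, one layer
    at a time. *)
Lemma sqrt_minkowski (a b c d : R) : 0 <= a -> 0 <= b -> 0 <= c -> 0 <= d ->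
  Num.sqrt ((a + b) ^+ 2 + (c + d) ^+ 2) <=
  Num.sqrt (a ^+ 2 + c ^+ 2) + Num.sqrt (b ^+ 2 + d ^+ 2).
Proof.
move=> a0 b0 c0 d0.
set x := Num.sqrt (a ^+ 2 + c ^+ 2); set y := Num.sqrt (b ^+ 2 + d ^+ 2).
have x0 : 0 <= x by exact: sqrtr_ge0.
have y0 : 0 <= y by exact: sqrtr_ge0.
have xE : x ^+ 2 = a ^+ 2 + c ^+ 2 by rewrite sqr_sqrtr // addr_ge0 ?sqr_ge0.
have yE : y ^+ 2 = b ^+ 2 + d ^+ 2 by rewrite sqr_sqrtr // addr_ge0 ?sqr_ge0.
rewrite -[leRHS]ger0_norm ?addr_ge0 // -sqrtr_sqr ler_sqrt ?sqr_ge0 //.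
rewrite !sqrrD xE yE.
suff : a * b + c * d <= x * y by lra.
rewrite -ler_sqr ?nnegrE ?addr_ge0 ?mulr_ge0 // exprMn xE yE.
by have := sqr_ge0 (a * d - b * c); nra.
Qed.

Lemma weighted_cauchy n (k a : 'I_n -> R) :
  (forall i, 0 <= k i) -> (forall i, 0 <= a i) ->
  (\sum_i k i * a i) ^+ 2 <= (\sum_i k i) * (\sum_i k i * a i ^+ 2).
Proof.
elim: n k a => [|n IH] k a k0 a0; first by rewrite !big_ord0 mul0r expr0n.
rewrite !big_ord_recr /=.
have := IH (fun i => k (widen_ord (leqnSn n) i))
  (fun i => a (widen_ord (leqnSn n) i)) (fun i => k0 _) (fun i => a0 _).
set x := \sum_(i < n) _ * _; set K := \sum_(i < n) _; set Y := \sum_(i < n) _.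
have K0 : 0 <= K by apply: sumr_ge0 => i _.
have Y0 : 0 <= Y by apply: sumr_ge0 => i _; rewrite mulr_ge0 ?sqr_ge0.
have x0 : 0 <= x by apply: sumr_ge0 => i _; rewrite mulr_ge0.
have := k0 ord_max; have := a0 ord_max.
set c := k _; set b := a _ => b0 c0 xKY.
have h : 2 * x * b <= Y + K * b ^+ 2.
  rewrite -ler_sqr ?nnegrE ?addr_ge0 ?mulr_ge0 ?sqr_ge0 //.
  have := sqr_ge0 (Y - K * b ^+ 2).
  have : x ^+ 2 * b ^+ 2 <= K * Y * b ^+ 2 by rewrite ler_wpM2r ?sqr_ge0.
  by lra.
by have := ler_wpM2l c0 h; lra.
Qed.

(** Young's inequality for the convolution of an l^1 kernel with an l^2
    sequence. It keeps the coercivity constant independent of the horizon. *)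
Lemma young_convolution n N (k : 'I_n -> R) (p : nat -> R) :
  (forall i, 0 <= k i) -> (forall i, 0 <= p i) ->
  (forall i, (N < i)%N -> p i = 0) ->
  \sum_(m < N.+1) (\sum_(i < n) k i * p (m + i)%N) ^+ 2 <=
  (\sum_(i < n) k i) ^+ 2 * \sum_(m < N.+1) p m ^+ 2.
Proof.
move=> k0 p0 pN.
have shift (i : nat) :
    \sum_(m < N.+1) p (m + i)%N ^+ 2 <= \sum_(m < N.+1) p m ^+ 2.
  elim: i => [|i IH]; first by under eq_bigr do rewrite addn0.
  apply: le_trans IH; rewrite big_ord_recr big_ord_recl /=.
  rewrite [p (N + _)%N]pN; last by lia.
  rewrite expr0n addr0 ler_wpDl ?sqr_ge0 //.
  by apply: ler_sum => m _; rewrite addnS /bump /= add1n addSn.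
apply: (@le_trans _ _ (\sum_(m < N.+1) (\sum_i k i) * (\sum_i k i * p (m + i)%N ^+ 2))).
  by apply: ler_sum => m _; apply: weighted_cauchy.
rewrite -mulr_sumr expr2 -mulrA ler_wpM2l ?sumr_ge0 //.
rewrite exchange_big /= mulr_suml; apply: ler_sum => i _.
by rewrite -mulr_sumr ler_wpM2l.
Qed.

End Aux.

(** * Controllability windows and the backward recursion *)

Section Constants.
Set Implicit Arguments.
Unset Strict Implicit.
Context {R : realType}.
Variable U : R.

(** The geometric sum 1 + U + ... + U^(n-1). *)
Fixpoint geo (n : nat) : R := if n is n'.+1 then 1 + U * geo n' else 0.

(** The sum U^2 + U^4 + ... + U^(2n), the most that the last [n] inputs of a
    window can contribute to its Gramian. *)
Fixpoint rho (n : nat) : R := if n is n'.+1 then U ^+ 2 * (1 + rho n') else 0.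

Hypothesis U1 : 1 < U.
Let U0 : 0 < U. Proof. by apply: lt_trans U1. Qed.
Let U0' : 0 <= U. Proof. exact: ltW. Qed.

Lemma geo_ge0 n : 0 <= geo n.
Proof. by elim: n => //= n IH; rewrite addr_ge0 ?mulr_ge0. Qed.

Lemma rho_ge0 n : 0 <= rho n.
Proof. by elim: n => //= n IH; rewrite mulr_ge0 ?addr_ge0 ?sqr_ge0. Qed.

Lemma rho_le n : rho n <= rho n.+1.
Proof.
by elim: n => [|n IH]; [exact: rho_ge0|rewrite ler_wpM2l ?sqr_ge0 // lerD2l].
Qed.

Lemma rho_mono m n : (m <= n)%N -> rho m <= rho n.
Proof.
move=> /subnK <-; elim: (n - m)%N => // k IH.
by apply: le_trans IH _; rewrite addSn; exact: rho_le.
Qed.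

Lemma exp1U_ge1 n : 1 <= (1 + U) ^+ n.
Proof. by rewrite exprn_ege1 // lerDl. Qed.

Lemma geoS_le n : geo n.+1 <= (1 + U) ^+ n.
Proof.
elim: n => [|n IH]; first by rewrite /= mulr0 addr0 expr0.
rewrite [geo _]/= -/(geo n.+1) exprS mulrDl mul1r.
by rewrite lerD ?exp1U_ge1 // ler_wpM2l.
Qed.

Lemma sum_geo n : \sum_(i < n) U ^+ i = geo n.
Proof.
elim: n => [|n IH]; first by rewrite big_ord0.
rewrite big_ord_recl /= -IH mulr_sumr expr0; congr (_ + _).
by apply: eq_bigr => i _; rewrite exprS.
Qed.

Lemma geo_le n : geo n <= (1 + U) ^+ n.
Proof.
case: n => [|n]; first by rewrite expr0.
apply: le_trans (geoS_le n) _; rewrite exprS ler_peMl //.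
  by apply: le_trans (exp1U_ge1 n).
by rewrite lerDl.
Qed.

Lemma rho_sq_le n : rho n <= ((1 + U) ^+ n) ^+ 2.
Proof.
have h : rho n + 1 <= ((1 + U) ^+ n) ^+ 2.
  elim: n => [|n IH]; first by rewrite /= add0r expr0 expr1n.
  rewrite /= [X in _ <= X ^+ 2]exprS exprMn.
  have X1 : 1 <= ((1 + U) ^+ n) ^+ 2 by rewrite exprn_ege1 // exp1U_ge1.
  have := ler_wpM2l (sqr_ge0 U) IH; set X := (_ ^+ n) ^+ 2 in IH X1 *.
  have : U * 1 <= U * X by rewrite ler_wpM2l.
  by have := U1; nra.
by apply: le_trans h; rewrite lerDl.
Qed.

Lemma sum_geo_le n : U * \sum_(i < n) geo i.+1 <= (1 + U) ^+ n.
Proof.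
suff : U * \sum_(i < n) geo i.+1 + 1 <= (1 + U) ^+ n by apply: le_trans; rewrite lerDl.
elim: n => [|n IH]; first by rewrite big_ord0 mulr0 add0r expr0.
rewrite big_ord_recr exprS /= -/(geo n.+1).
have := ler_wpM2l U0' (geoS_le n).
by rewrite /=; lra.
Qed.

(** The number of steps by which windows are shortened is the largest one whose
    contribution stays below the budget [g], up to the window bound [t]. *)
Lemma shrink_depth (g : R) (t : nat) : 0 < g ->
  exists2 r, (r <= t)%N & rho r <= g /\ (r = t \/ g < rho r.+1).
Proof.
move=> g0; elim: t => [|t [r rt [rg [rt'|gr]]]].
- by exists 0%N => //; split; [exact: ltW|left].
- case: (leP (rho t.+1) g) => h.
    by exists t.+1 => //; split=> //; left.
  by exists t; [exact: leqnSn|split; [rewrite -rt'|right]].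
by exists r; [exact: leqW|split=> //; right].
Qed.

End Constants.

Section Window.
Set Implicit Arguments.
Unset Strict Implicit.
Context {R : realType} {nx nu : nat}.
Variables (A : nat -> 'M[R]_nx) (B : nat -> 'M[R]_(nx, nu)) (U : R).
Hypothesis U1 : 1 < U.
Hypothesis AU : forall k v, enorm ((A k)^T *m v) <= U * enorm v.
Hypothesis BU : forall k v, enorm ((B k)^T *m v) <= U * enorm v.

Let U0 : 0 < U. Proof. by apply: lt_trans U1. Qed.
Let U0' : 0 <= U. Proof. exact: ltW. Qed.

(** The norm of the transposed controllability matrix of the window
    [m, m + n) applied to [f] (see [enorm_ctrl_mx]). In this recursive form,
    removing the last step of the window removes one layer. *)
Fixpoint reach (m n : nat) (f : 'cV[R]_nx) : R :=
  if n is n'.+1 then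
    Num.sqrt (reach m n' ((A (m + n'))^T *m f) ^+ 2
              + enorm ((B (m + n'))^T *m f) ^+ 2)
  else 0.

Lemma reach_ge0 m n f : 0 <= reach m n f.
Proof. by case: n => //= n; exact: sqrtr_ge0. Qed.

Lemma reachS_sq m n f : reach m n.+1 f ^+ 2 =
  reach m n ((A (m + n))^T *m f) ^+ 2 + enorm ((B (m + n))^T *m f) ^+ 2.
Proof. by rewrite /= sqr_sqrtr // addr_ge0 ?sqr_ge0. Qed.

Lemma sqrt_add_le (x y : R) : 0 <= x -> 0 <= y ->
  Num.sqrt (x ^+ 2 + y ^+ 2) <= x + y.
Proof.
move=> x0 y0; rewrite -[leRHS]ger0_norm ?addr_ge0 // -sqrtr_sqr.
by rewrite ler_sqrt ?sqr_ge0 // sqrrD; have := mulr_ge0 x0 y0; lra.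
Qed.

Lemma reach_le m n f : reach m n f <= U * geo U n * enorm f.
Proof.
elim: n f => [|n IH] f /=; first by rewrite mulr0 mul0r.
apply: le_trans (sqrt_add_le (reach_ge0 _ _ _) (enorm_ge0 _)) _.
have h1 := IH ((A (m + n))^T *m f).
have h2 := AU (m + n) f.
have h3 := BU (m + n) f.
have := ler_wpM2l (mulr_ge0 U0' (geo_ge0 U1 n)) h2.
by lra.
Qed.

Lemma reachD m n f g : reach m n (f + g) <= reach m n f + reach m n g.
Proof.
elim: n f g => [|n IH] f g /=; first by rewrite addr0.
apply: le_trans (sqrt_minkowski _ _ _ _); rewrite ?reach_ge0 ?enorm_ge0 //.
rewrite ler_sqrt ?addr_ge0 ?sqr_ge0 // !mulmxDr lerD //.
  by rewrite ler_sqr ?nnegrE ?addr_ge0 ?reach_ge0.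
by rewrite ler_sqr ?nnegrE ?addr_ge0 ?enorm_ge0 // enormD.
Qed.

Lemma invertible_inj n (M : 'M[R]_n) :
  (forall v : 'cV[R]_n, M *m v = 0 -> v = 0) -> M \in unitmx.
Proof.
move=> inj; rewrite -unitmx_tr -row_free_unit -kermx_eq0.
apply/eqP/row_matrixP => i; rewrite row0.
have rK : row i (kermx M^T) *m M^T = 0 by apply/sub_kermxP; exact: row_sub.
apply: trmx_inj; rewrite trmx0; apply: inj; apply: trmx_inj.
by rewrite trmx_mul trmxK trmx0.
Qed.

(** If the last input alone cannot account for the bound [c], then the rest of
    the window sees every vector in the range of [A^T]. This makes [A^T]
    injective, hence surjective, and its norm is at most [U], so the shorter
    window sees every vector, with constant [(c - U^2) / U^2]. *)
Lemma reach_shorten1 m n c :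
  U ^+ 2 < c -> (forall f, c * enorm f ^+ 2 <= reach m n.+1 f ^+ 2) ->
  forall f, (c - U ^+ 2) * enorm f ^+ 2 <= U ^+ 2 * reach m n f ^+ 2.
Proof.
move=> Uc hc.
have h f : (c - U ^+ 2) * enorm f ^+ 2 <= reach m n ((A (m + n))^T *m f) ^+ 2.
  have := hc f; rewrite reachS_sq.
  have : enorm ((B (m + n))^T *m f) ^+ 2 <= (U * enorm f) ^+ 2.
    by rewrite ler_sqr ?nnegrE ?mulr_ge0 ?enorm_ge0.
  by rewrite exprMn; lra.
have reach0 : reach m n 0 = 0.
  apply/eqP; rewrite eq_le reach_ge0 andbT.
  by apply: le_trans (reach_le _ _ _) _; rewrite enorm0 mulr0.
have inv : (A (m + n))^T \in unitmx.
  apply: invertible_inj => v Av0; apply: enorm_eq0; apply/eqP.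
  have := h v; rewrite Av0 reach0 expr0n /= pmulr_rle0 ?subr_gt0 //.
  by rewrite -sqrf_eq0 eq_le sqr_ge0 => ->.
move=> g; have := h (invmx (A (m + n))^T *m g).
rewrite mulmxA mulmxV // mul1mx.
have := AU (m + n) (invmx (A (m + n))^T *m g).
rewrite mulmxA mulmxV // mul1mx => gle hle.
have : enorm g ^+ 2 <= (U * enorm (invmx (A (m + n))^T *m g)) ^+ 2.
  by rewrite ler_sqr ?nnegrE ?mulr_ge0 ?enorm_ge0.
rewrite exprMn => gle2.
have c0 : 0 <= c - U ^+ 2 by rewrite subr_ge0 ltW.
apply: le_trans (ler_wpM2l c0 gle2) _.
by rewrite mulrCA ler_wpM2l ?sqr_ge0.
Qed.

Lemma reach_shorten m n r c :
  rho U r < c -> (forall f, c * enorm f ^+ 2 <= reach m (n + r) f ^+ 2) ->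
  forall f, (c - rho U r) * enorm f ^+ 2 <= (U ^+ r) ^+ 2 * reach m n f ^+ 2.
Proof.
elim: r c => [|r IH] c rc hc f.
  by rewrite subr0 expr0 expr1n mul1r -[n in reach m n]addn0.
have U20 : 0 < U ^+ 2 by rewrite exprn_gt0.
have Uc : U ^+ 2 < c.
  by apply: le_lt_trans rc; rewrite /= mulrDr mulr1 lerDl mulr_ge0 ?sqr_ge0 ?rho_ge0.
have h := @reach_shorten1 m (n + r) c Uc.
rewrite -addnS in h; have {}h := h hc.
have rc' : rho U r < (c - U ^+ 2) / U ^+ 2.
  by rewrite ltr_pdivlMr //; move: rc => /=; lra.
have h' g : (c - U ^+ 2) / U ^+ 2 * enorm g ^+ 2 <= reach m (n + r) g ^+ 2.
  by rewrite mulrAC ler_pdivrMr // [leRHS]mulrC.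
have := IH _ rc' h' f; rewrite -(ler_pM2l U20).
have -> : U ^+ 2 * (((c - U ^+ 2) / U ^+ 2 - rho U r) * enorm f ^+ 2) =
   (c - rho U r.+1) * enorm f ^+ 2.
  by rewrite /=; field; rewrite gt_eqF.
by rewrite [X in _ -> _ <= X ^+ 2 * _]exprS; lra.
Qed.

Variables (N : nat) (lam px : nat -> 'cV[R]_nx) (pu : nat -> 'cV[R]_nu).
Variable (pn : nat -> R).
Hypothesis lam_rec : forall k, (k < N)%N -> lam k = (A k)^T *m lam k.+1 + px k.
Hypothesis pu_rec : forall k, (k < N)%N -> (B k)^T *m lam k.+1 = - pu k.
Hypothesis lamN : lam N = px N.
Hypothesis px_le : forall k, enorm (px k) <= pn k.
Hypothesis pu_le : forall k, (k < N)%N -> enorm (pu k) <= pn k.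

Let pn0 k : 0 <= pn k. Proof. exact: le_trans (enorm_ge0 _) (px_le k). Qed.

(** At each step the layer [B^T] contributes the known value [pu], and passing
    from [A^T lam (k+1)] to [lam k] costs the defect [px], amplified by the
    inputs that lie before it in the window. *)
Lemma reach_lam m n : (m + n <= N)%N ->
  reach m n (lam (m + n)) <= \sum_(i < n) geo U i.+1 * pn (m + i).
Proof.
elim: n => [|n IH] mn; first by rewrite big_ord0.
rewrite big_ord_recr /=; rewrite addnS in mn *.
apply: le_trans (sqrt_add_le (reach_ge0 _ _ _) (enorm_ge0 _)) _.
rewrite pu_rec // enormN.
have -> : (A (m + n))^T *m lam (m + n).+1 = lam (m + n) + - px (m + n).
  by rewrite [X in _ = X + _]lam_rec // addrK.
have h1 := reachD m n (lam (m + n)) (- px (m + n)).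
have h2 := IH (ltnW mn).
have h3 := reach_le m n (- px (m + n)); rewrite enormN in h3.
have h4 := ler_wpM2l (mulr_ge0 U0' (geo_ge0 U1 n)) (px_le (m + n)).
have h5 := pu_le mn.
by lra.
Qed.

Lemma lam_unroll m n : (m + n <= N)%N ->
  enorm (lam m) <= \sum_(i < n) U ^+ i * pn (m + i) + U ^+ n * enorm (lam (m + n)).
Proof.
elim: n => [|n IH] mn; first by rewrite big_ord0 add0r expr0 mul1r addn0.
rewrite addnS in mn *; apply: le_trans (IH (ltnW mn)) _.
rewrite big_ord_recr /= -addrA lerD2l exprSr -mulrA -mulrDr.
rewrite ler_wpM2l ?exprn_ge0 // [X in enorm X]lam_rec //.
apply: le_trans (enormD _ _) _; rewrite addrC lerD //.
Qed.

Lemma lam_tail m : (m <= N)%N ->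
  enorm (lam m) <= \sum_(i < (N - m).+1) U ^+ i * pn (m + i).
Proof.
move=> mN; have := @lam_unroll m (N - m); rewrite subnKC // => /(_ (leqnn _)).
by move=> h; apply: le_trans h _; rewrite big_ord_recr /= subnKC // lerD2l ler_wpM2l
  ?exprn_ge0 // lamN.
Qed.

(** The window is shortened by [minn r s] steps before [lam] is recovered at its
    end. The recovery loses [U^(minn r s) / sqrt (g / 2)] and unrolling from
    there loses the remaining power, [U^s] in total; the shortening pays off in
    the number of terms of the sum. *)
Lemma lam_window m s r g : 0 < g -> (m + s <= N)%N -> rho U r <= g / 2 ->
  (forall f, g * enorm f ^+ 2 <= reach m s f ^+ 2) ->
  enorm (lam m) <= \sum_(i < s - r)
     (U ^+ i + U ^+ s / Num.sqrt (g / 2) * geo U i.+1) * pn (m + i).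
Proof.
move=> g0 ms rg hg.
pose k := minn r s; pose j := (s - r)%N.
have js : (j + k)%N = s by rewrite /j /k; lia.
have kg : rho U k <= g / 2.
  by apply: le_trans rg; apply: rho_mono => //; exact: geq_minl.
have kg' : rho U k < g by lra.
have g20 : 0 < g / 2 by rewrite divr_gt0.
have sg0 : 0 < Num.sqrt (g / 2) by rewrite sqrtr_gt0.
have mjN : (m + j <= N)%N by lia.
have := @reach_shorten m j k g kg'; rewrite js => /(_ hg (lam (m + j))) h.
set S := \sum_(i < j) geo U i.+1 * pn (m + i).
have S0 : 0 <= S by apply: sumr_ge0 => i _; rewrite mulr_ge0 ?geo_ge0.
have hl : Num.sqrt (g / 2) * enorm (lam (m + j)) <= U ^+ k * S.
  rewrite -ler_sqr ?nnegrE ?mulr_ge0 ?enorm_ge0 ?exprn_ge0 ?sqrtr_ge0 //.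
  rewrite !exprMn sqr_sqrtr ?(ltW g20) //.
  have h1 : reach m j (lam (m + j)) ^+ 2 <= S ^+ 2.
    by rewrite ler_sqr ?nnegrE ?reach_ge0 //; exact: reach_lam.
  have h2 := ler_wpM2l (sqr_ge0 (U ^+ k)) h1.
  apply: le_trans h2; apply: le_trans h.
  by rewrite ler_wpM2r ?sqr_ge0 //; lra.
apply: le_trans (lam_unroll mjN) _.
under [leRHS]eq_bigr do rewrite mulrDl.
rewrite big_split /= -/j lerD2l.
under [leRHS]eq_bigr do rewrite -mulrA.
rewrite -mulr_sumr -/S mulrAC ler_pdivlMr // -js exprD -!mulrA ler_wpM2l ?exprn_ge0 //.
by rewrite mulrC.
Qed.

(** A bound on the weights of the data in [lam m] that is common to all window
    lengths [s <= t] and to the tail of the horizon. *)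
Definition window_weight (g : R) (t r i : nat) : R :=
  U ^+ i + (if (i < t - r)%N then U ^+ t / Num.sqrt (g / 2) * geo U i.+1 else 0).

Lemma window_weight_ge0 g t r i : 0 <= window_weight g t r i.
Proof.
rewrite /window_weight addr_ge0 ?exprn_ge0 //; case: ifP => // _.
by rewrite mulr_ge0 ?divr_ge0 ?geo_ge0 ?exprn_ge0 ?sqrtr_ge0.
Qed.

(** Near the end of the horizon, where no window is available, the terminal
    condition replaces controllability: fewer than [t] steps remain to
    unroll. *)
Lemma lam_le_weight g t r m : 0 < g -> rho U r <= g / 2 ->
  (forall k, (k + t <= N)%N -> exists2 s, (s <= t)%N &
     forall f, g * enorm f ^+ 2 <= reach k s f ^+ 2) ->
  (m <= N)%N ->
  enorm (lam m) <= \sum_(i < t) window_weight g t r i * pn (m + i).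
Proof.
move=> g0 rg ctrl mN.
have trunc (j : nat) (F : nat -> R) : (j <= t)%N ->
    (forall i, (i < j)%N -> F i <= window_weight g t r i) ->
    \sum_(i < j) F i * pn (m + i) <= \sum_(i < t) window_weight g t r i * pn (m + i).
  move=> jt hF; rewrite (big_ord_widen t (fun i => F i * pn (m + i)%N) jt).
  rewrite [leRHS](bigID (fun i : 'I_t => (i < j)%N)) /= ler_wpDr //.
    by apply: sumr_ge0 => i _; rewrite mulr_ge0 ?window_weight_ge0.
  by apply: ler_sum => i ij; rewrite ler_wpM2r // hF.
case: (leqP (m + t) N) => [mt|mt]; last first.
  apply: le_trans (lam_tail mN) _.
  apply: (trunc _ (fun i => U ^+ i)); first by lia.
  move=> i _; rewrite /window_weight lerDl; case: ifP => // _.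
  by rewrite mulr_ge0 ?divr_ge0 ?geo_ge0 ?exprn_ge0 ?sqrtr_ge0.
have [s st hs] := ctrl m mt.
have msN : (m + s <= N)%N by lia.
apply: le_trans (lam_window g0 msN rg hs) _.
apply: (trunc _ (fun i => U ^+ i + U ^+ s / Num.sqrt (g / 2) * geo U i.+1)); first by lia.
move=> i isr; rewrite /window_weight ifT; last by lia.
rewrite lerD2l ler_wpM2r ?geo_ge0 // ler_wpM2r ?invr_ge0 ?sqrtr_ge0 //.
by rewrite ler_weXn2l // ltW.
Qed.

(** If [r < t], maximality gives [sqrt (g / 2) <= (1 + U)^(r+1)], so that
    [1 / sqrt (g / 2) <= 2 (1 + U)^(r+1) / g]. The power of [1 + U] gained here
    combines with the bound [(1 + U)^(t-r)] on the remaining geometric sums into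
    [(1 + U)^(t+1)], whatever [r] is. *)
Lemma sum_weight_le g t r : 0 < g -> (r <= t)%N -> (r = t \/ g / 2 < rho U r.+1) ->
  \sum_(i < t) window_weight g t r i <=
  2 * (1 + U ^+ t.+1 / (U - 1) / g) * (1 + U) ^+ t.
Proof.
move=> g0 rt hr; rewrite /window_weight big_split /= sum_geo.
have Um1 : 0 < U - 1 by rewrite subr_gt0.
set Q := U ^+ t.+1 / (U - 1) / g.
have Q0 : 0 <= Q by rewrite !divr_ge0 ?exprn_ge0 // ltW.
have E1 := exp1U_ge1 U1 t.
have h1 := geo_le U1 t.
suff h2 : \sum_(i < t) (if (i < t - r)%N then
    U ^+ t / Num.sqrt (g / 2) * geo U i.+1 else 0) <= 2 * Q * (1 + U) ^+ t.
  by lra.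
rewrite -big_mkcond /=.
rewrite -(big_ord_widen t (fun i => U ^+ t / Num.sqrt (g / 2) * geo U i.+1)
   (leq_subr r t)) -mulr_sumr.
case: hr => [->|hr].
  by rewrite subnn big_ord0 mulr0; nra.
set s := Num.sqrt (g / 2).
have g20 : 0 < g / 2 by rewrite divr_gt0.
have s0 : 0 < s by rewrite sqrtr_gt0.
have s2 : s ^+ 2 = g / 2 by rewrite sqr_sqrtr // ltW.
have ss : s <= (1 + U) ^+ r.+1.
  rewrite -ler_sqr ?nnegrE ?exprn_ge0 ?addr_ge0 ?sqrtr_ge0 // s2.
  by apply: le_trans (rho_sq_le U1 _); exact: ltW.
have hT := sum_geo_le U1 (t - r).
set T := \sum_(i < t - r) _ in hT *.
have T0 : 0 <= T by apply: sumr_ge0 => i _; exact: geo_ge0.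
have gE : g = 2 * s ^+ 2 by rewrite s2; field.
have -> : 2 * Q * (1 + U) ^+ t = U ^+ t.+1 * (1 + U) ^+ t / ((U - 1) * s ^+ 2).
  by rewrite /Q gE; field; rewrite !gt_eqF.
rewrite ler_pdivlMr ?mulr_gt0 ?exprn_gt0 //.
have -> : U ^+ t / s * T * ((U - 1) * s ^+ 2) = U ^+ t * (s * T * (U - 1)).
  by field; rewrite gt_eqF.
rewrite exprSr -[leRHS]mulrA ler_wpM2l ?exprn_ge0 // -(ler_pM2l U0).
have E : (1 + U) * (1 + U) ^+ t = (1 + U) ^+ r.+1 * (1 + U) ^+ (t - r).
  by rewrite -exprD -exprS; congr (_ ^+ _); lia.
have sT : s * (U * T) <= (1 + U) * (1 + U) ^+ t.
  by rewrite E; apply: ler_pM => //; rewrite ?mulr_ge0 // ltW.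
have := ler_wpM2r (ltW Um1) sT.
by have := E1; nra.
Qed.

(** The square of the total weight is at most [4 / gammaG], because
    [gC / (gC + X) = 1 / (1 + X / gC)] and the minimum in [gammaG] is at
    most 1. *)
Lemma sum_lam_le gC t : 0 < gC -> (forall k, (N < k)%N -> pn k = 0) ->
  (forall k, (k + t <= N)%N -> exists2 s, (s <= t)%N &
     forall f, gC * enorm f ^+ 2 <= reach k s f ^+ 2) ->
  gammaG gC U t / 4 * \sum_(k < N.+1) enorm (lam k) ^+ 2
    <= \sum_(k < N.+1) pn k ^+ 2.
Proof.
move=> g0 pnN ctrl.
have g20 : 0 < gC / 2 by rewrite divr_gt0.
have [r rt [rg hr]] := shrink_depth U t g20.
have hk := sum_weight_le g0 rt hr.
set K := \sum_(i < t) _ in hk.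
have K0 : 0 <= K by apply: sumr_ge0 => i _; exact: window_weight_ge0.
set S := \sum_(k < N.+1) pn k ^+ 2.
have S0 : 0 <= S by apply: sumr_ge0 => i _; exact: sqr_ge0.
have h : \sum_(k < N.+1) enorm (lam k) ^+ 2 <= K ^+ 2 * S.
  apply: le_trans (young_convolution (k := fun i : 'I_t => window_weight gC t r i) _ pn0 pnN).
    apply: ler_sum => k _; rewrite ler_sqr ?nnegrE ?enorm_ge0 //.
      by apply: lam_le_weight => //; rewrite -ltnS.
    by apply: sumr_ge0 => i _; rewrite mulr_ge0 ?window_weight_ge0.
  by move=> i; exact: window_weight_ge0.
have Um1 : 0 < U - 1 by rewrite subr_gt0.
set Q := U ^+ t.+1 / (U - 1) / gC in hk.
have Q0 : 0 <= Q by rewrite !divr_ge0 ?exprn_ge0 // ltW.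
set E := (1 + U) ^+ t in hk *.
have E0 : 0 < E by rewrite exprn_gt0 // addr_gt0.
have hG0 : 0 <= gammaG gC U t.
  rewrite /gammaG mulr_ge0 ?sqr_ge0 // divr_ge0 ?exprn_ge0 ?addr_ge0 //.
  by rewrite le_min ler01 ltW.
have hG : gammaG gC U t <= ((1 + Q) * E) ^- 2.
  rewrite /gammaG.
  have -> : gC / (gC + U ^+ t.+1 / (U - 1)) = (1 + Q)^-1.
    rewrite /Q; field; rewrite !gt_eqF //.
    by rewrite addr_gt0 ?exprn_gt0 // mulr_gt0.
  rewrite exprMn invfM exprVn ler_wpM2l ?invr_ge0 ?sqr_ge0 //.
  rewrite mulnC exprM -/E.
  have E20 : 0 < E ^+ 2 by rewrite exprn_gt0.
  by rewrite ler_pdivrMr // mulVf ?gt_eqF // ge_min lexx.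
have hG4 : gammaG gC U t / 4 * K ^+ 2 <= 1.
  have KE : K ^+ 2 <= 4 * ((1 + Q) * E) ^+ 2.
    have -> : 4 * ((1 + Q) * E) ^+ 2 = (2 * (1 + Q) * E) ^+ 2 by ring.
    by rewrite ler_sqr ?nnegrE // !mulr_ge0 ?addr_ge0 // ltW.
  have X0 : 0 < ((1 + Q) * E) ^+ 2.
    by rewrite exprn_gt0 // mulr_gt0 // ltr_wpDr.
  rewrite -[leRHS](mulVf (lt0r_neq0 X0)).
  have G40 : 0 <= gammaG gC U t / 4 by rewrite divr_ge0.
  apply: le_trans (ler_wpM2l G40 KE) _.
  have := ler_wpM2r (ltW X0) hG; lra.
have G40 : 0 <= gammaG gC U t / 4 by rewrite divr_ge0.
apply: le_trans (ler_wpM2l G40 h) _.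
by rewrite mulrA ler_piMl.
Qed.

End Window.

(** * Coercivity of the transposed constraint Jacobian *)

Section Gramian.
Set Implicit Arguments.
Unset Strict Implicit.
Context {R : realType} {nx nu : nat}.
Variables (A : nat -> 'M[R]_nx) (B : nat -> 'M[R]_(nx, nu)).

Lemma reach_sum m s f : reach A B m s f ^+ 2 =
  \sum_(j < s) enorm ((transition A (m + s - j) j *m B (m + s - j.+1)%N)^T *m f) ^+ 2.
Proof.
elim: s f => [|s IH] f; first by rewrite big_ord0 expr0n.
rewrite reachS_sq IH big_ord_recl /= addrC mul1mx subn1 addnS /=; congr (_ + _).
apply: eq_bigr => j _; rewrite /bump /= add1n !subSS.
rewrite subnK; last by have := ltn_ord j; lia.
by rewrite -mulmxA [X in _ = enorm (X *m _) ^+ 2]trmx_mul mulmxA.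
Qed.

Lemma enorm_ctrl_mx m s f :
  enorm ((ctrl_mx A B m s)^T *m f) ^+ 2 = reach A B m s f ^+ 2.
Proof.
rewrite reach_sum enorm_sq /ctrl_mx tr_mxrow mxcol_mul dotv_mxcol.
by apply: eq_bigr => j _; rewrite mxcolK -enorm_sq.
Qed.

(** The controllability hypothesis in the form used on windows. *)
Lemma loewner_ctrl gC m s f :
  loewner_ge (ctrl_mx A B m s *m (ctrl_mx A B m s)^T) gC%:M ->
  gC * enorm f ^+ 2 <= reach A B m s f ^+ 2.
Proof.
move=> [_ /(_ f)]; rewrite -enorm_ctrl_mx -mulmxA -/(dotv f _) mulmxBl dotvBr.
by rewrite mul_scalar_mx dotvZr -mulmxA dotv_mulr -!enorm_sq subr_ge0.
Qed.

End Gramian.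

Section Jacobian.
Set Implicit Arguments.
Unset Strict Implicit.
Context {R : realType} {N nx nu : nat}.
Variable P : ocp R N nx nu.
Hypothesis smooth : thrice_cont_diff P.
Notation zv := ('cV[R]_(zdim N nx nu)).
Notation lv := ('cV[R]_(ldim N nx)).

Lemma dotv_zv (u v : zv) :
  dotv u v = \sum_(k < N) dotv (stage u k) (stage v k) + dotv (stageN u) (stageN v).
Proof.
rewrite -{1}(vsubmxK u) -{1}(vsubmxK v) dotv_col_mx; congr (_ + _).
exact: dotv_mxcol.
Qed.

Lemma dotv_lv (u v : lv) : dotv u v = \sum_k dotv (mult u k) (mult v k).
Proof. exact: dotv_mxcol. Qed.

Lemma state_widen (w : zv) (k : 'I_N) :
  state w (widen_ord (leqnSn N) k) = usubmx (stage w k).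
Proof.
rewrite /state.
have -> : widen_ord (leqnSn N) k = lift ord_max k.
  by apply: val_inj; rewrite /= /bump leqNgt ltn_ord.
by rewrite liftK.
Qed.

Lemma state_max (w : zv) : state w ord_max = stageN w.
Proof. by rewrite /state unlift_none. Qed.

Lemma dotv_inj n (u v : 'cV[R]_n) : (forall w, dotv w u = dotv w v) -> u = v.
Proof.
move=> h; apply/eqP; rewrite -subr_eq0; apply/eqP/enorm_eq0/eqP.
by rewrite -sqrf_eq0 enorm_sq dotvBr h subrr.
Qed.

Definition adjoint_block (z : zv) (l : lv) (k : 'I_N) : 'cV[R]_(nx + nu) :=
  col_mx (mult l (widen_ord (leqnSn N) k)
          - (Amx P k (stage z k))^T *m mult l (lift ord0 k))
         (- ((Bmx P k (stage z k))^T *m mult l (lift ord0 k))).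

(** Identified by testing against every [w]: a summation by parts over the
    stages moves the shift from the states to the multipliers. *)
Lemma trmul_Gmx z l :
  (Gmx P z)^T *m l = col_mx (\mxcol_(k < N) adjoint_block z l k) (mult l ord_max).
Proof.
apply: dotv_inj => w; rewrite dotv_mulr trmxK dotv_lv big_ord_recl.
rewrite mult_mul_Gmx0 //.
have -> : \sum_(j < N) dotv (mult (Gmx P z *m w) (lift ord0 j)) (mult l (lift ord0 j)) =
    \sum_(j < N) dotv (state w (lift ord0 j)) (mult l (lift ord0 j)) -
    \sum_(j < N) dotv (Amx P j (stage z j) *m usubmx (stage w j)
       + Bmx P j (stage z j) *m dsubmx (stage w j)) (mult l (lift ord0 j)).
  by rewrite -sumrB; apply: eq_bigr => j _; rewrite mult_mul_Gmx // dotvBl.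
rewrite addrA -(big_ord_recl N (fun k => dotv (state w k) (mult l k))).
rewrite big_ord_recr /= state_max dotv_zv /stageN col_mxKd addrAC; congr (_ + _).
rewrite -sumrB; apply: eq_bigr => k _.
rewrite /stage col_mxKu mxcolK -/(stage w k) state_widen /adjoint_block.
rewrite -[X in _ = dotv X _]vsubmxK dotv_col_mx dotvBr dotvNr dotvDl !dotv_mull.
by rewrite opprD addrA.
Qed.

Lemma stage_trmul_Gmx z l k : stage ((Gmx P z)^T *m l) k = adjoint_block z l k.
Proof. by rewrite trmul_Gmx /stage col_mxKu mxcolK. Qed.

Lemma stageN_trmul_Gmx z l : stageN ((Gmx P z)^T *m l) = mult l ord_max.
Proof. by rewrite trmul_Gmx /stageN col_mxKd. Qed.

(** The recursion determines the multipliers backward from the last one. *)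
Lemma Gmx_trmul_inj (z : zv) (l : lv) : (Gmx P z)^T *m l = 0 -> l = 0.
Proof.
move=> Gl0; have h n (k : 'I_N.+1) : (N - k <= n)%N -> mult l k = 0.
  elim: n k => [|n IH] k kn.
    have -> : k = ord_max by apply: val_inj; have := ltn_ord k => /=; lia.
    by rewrite -(stageN_trmul_Gmx z) Gl0 /stageN; apply/colP => i; rewrite !mxE.
  case: (unliftP ord_max k) => [j kE|->]; last by apply: IH; rewrite /= subnn.
  have kj : k = j :> nat by rewrite kE /= /bump leqNgt ltn_ord.
  have := stage_trmul_Gmx z l j; rewrite Gl0 /adjoint_block.
  rewrite (IH (lift ord0 j)); last first.
    by rewrite lift0 subnS -kj; move: kn; case: (N - k)%N.
  have -> : widen_ord (leqnSn N) j = k by apply: val_inj; rewrite /= -kj.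
  rewrite mulmx0 subr0 => /(congr1 usubmx); rewrite col_mxKu => <-.
  by apply/colP => i; rewrite !mxE.
apply/mxcolP => k; rewrite -/(mult l k) (h N) ?leq_subr //.
by apply/colP => i; rewrite !mxE.
Qed.

(** The estimate [sum_lam_le] applied to the blocks of [G^T l], with the
    sequences extended by zero beyond the horizon. *)
Lemma Gmx_coercive gC U t Hh HhN (z : zv) (l : lv) :
  0 < gC -> 1 < U -> controllable P gC t z -> upper_bounded P U Hh HhN z ->
  gammaG gC U t / 4 * enorm l ^+ 2 <= enorm ((Gmx P z)^T *m l) ^+ 2.
Proof.
move=> g0 U1 ctrl [upper _].
have U0 : 0 <= U by apply: le_trans (ltW U1).
pose A := ext0 (fun i => Amx P i (stage z i)).
pose B := ext0 (fun i => Bmx P i (stage z i)).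
have Aj (j : 'I_N) : A j = Amx P j (stage z j) by rewrite /A /ext0 valK.
have Bj (j : 'I_N) : B j = Bmx P j (stage z j) by rewrite /B /ext0 valK.
have AU k v : enorm ((A k)^T *m v) <= U * enorm v.
  rewrite /A /ext0; case: insubP => [j _ _|_].
    by apply: enorm_trmul_le => //; have [] := upper j.
  by rewrite trmx0 mul0mx enorm0 mulr_ge0 ?enorm_ge0.
have BU k v : enorm ((B k)^T *m v) <= U * enorm v.
  rewrite /B /ext0; case: insubP => [j _ _|_].
    by apply: enorm_trmul_le => //; have [] := upper j.
  by rewrite trmx0 mul0mx enorm0 mulr_ge0 ?enorm_ge0.
set p := (Gmx P z)^T *m l.
pose lam k := mult l (inord k).
pose px k := if insub k is Some j then usubmx (stage p j)
             else if k == N then stageN p else 0.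
pose pu k := if insub k is Some j then dsubmx (stage p j) else 0.
pose pn k := if insub k is Some j then enorm (stage p j)
             else if k == N then enorm (stageN p) else 0.
have insN : insub N = None :> option 'I_N by rewrite insubN // ltnn.
have sub_le (v : 'cV[R]_(nx + nu)) : enorm (usubmx v) <= enorm v /\ enorm (dsubmx v) <= enorm v.
  split; rewrite -ler_sqr ?nnegrE ?enorm_ge0 // -[X in _ <= enorm X ^+ 2]vsubmxK;
  by rewrite enorm_col_mx ?lerDl ?lerDr ?sqr_ge0.
have lamS (j : 'I_N) : lam j.+1 = mult l (lift ord0 j).
  by rewrite /lam; congr mult; apply: val_inj; rewrite /= inordK // ltnS.
have lamW (j : 'I_N) : lam j = mult l (widen_ord (leqnSn N) j).
  by rewrite /lam; congr mult; apply: val_inj; rewrite /= inordK // ltnW // ltnS.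
have lamNE : lam N = mult l ord_max.
  by rewrite /lam; congr mult; apply: val_inj; rewrite /= inordK.
have := @sum_lam_le _ _ _ A B U U1 AU BU N lam px pu pn _ _ _ _ _ gC t g0.
have -> : \sum_(k < N.+1) enorm (lam k) ^+ 2 = enorm l ^+ 2.
  rewrite [RHS]enorm_sq dotv_lv; apply: eq_bigr => k _.
  by rewrite /lam inord_val enorm_sq.
have -> : \sum_(k < N.+1) pn k ^+ 2 = enorm p ^+ 2.
  rewrite [RHS]enorm_sq dotv_zv big_ord_recr /=; congr (_ + _).
    by apply: eq_bigr => k _; rewrite /pn valK enorm_sq.
  by rewrite /pn insN eqxx enorm_sq.
apply.
- move=> k kN; rewrite -[k]/(val (Ordinal kN)); set j := Ordinal kN.
  rewrite Aj lamS lamW /px valK stage_trmul_Gmx col_mxKu.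
  by rewrite addrC subrK.
- move=> k kN; rewrite -[k]/(val (Ordinal kN)); set j := Ordinal kN.
  by rewrite Bj lamS /pu valK stage_trmul_Gmx col_mxKd opprK.
- by rewrite lamNE /px insN eqxx stageN_trmul_Gmx.
- move=> k; rewrite /px /pn; case: insubP => [j _ _|_]; first by have [] := sub_le (stage p j).
  by case: eqP => _ //; rewrite enorm0.
- move=> k kN; rewrite /pu /pn insubT; by have [] := sub_le (stage p (Ordinal kN)).
- move=> k kN; rewrite /pn insubN; last by rewrite -leqNgt ltnW.
  by rewrite gtn_eqF.
- move=> k kt; have [s [/andP[_ st] hs]] := ctrl k kt.
  by exists s => // f; exact: loewner_ctrl.
Qed.

End Jacobian.

(** * The Newton system and the descent estimate *)

Section Linear.
Set Implicit Arguments.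
Unset Strict Implicit.
Context {R : realType}.

(** A maximal orthonormal family in the kernel spans it: otherwise the
    normalized residual of a projection would extend the family. *)
Lemma exists_onb_ker m n (M : 'M[R]_(m, n)) :
  exists d (Z : 'M[R]_(n, d)), orthonormal_basis_ker M Z.
Proof.
pose onf d := exists Z : 'M[R]_(n, d), Z^T *m Z = 1%:M /\ M *m Z = 0.
have onf0 : exists d, `[< onf d >].
  by exists 0%N; apply/asboolP; exists 0; split; [by apply/matrixP; case|exact: mulmx0].
have onf_le d : `[< onf d >] -> (d <= n)%N.
  move=> /asboolP [Z [ZZ _]]; rewrite -(mxrank1 R d) -ZZ.
  by apply: leq_trans (mxrankM_maxr _ _) _; exact: rank_leq_row.
case: (ex_maxnP onf0 onf_le) => d /asboolP [Z [ZZ MZ]] dmax.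
exists d, Z; split=> // w; split=> [Mw|[y ->]]; last by rewrite mulmxA MZ mul0mx.
exists (Z^T *m w); apply/eqP; rewrite -subr_eq0; apply/eqP.
set v := w - _.
have Mv : M *m v = 0 by rewrite /v mulmxBr Mw (mulmxA M) MZ mul0mx subr0.
have Zv : Z^T *m v = 0 by rewrite /v mulmxBr (mulmxA Z^T) ZZ mul1mx subrr.
apply: contrapT => /eqP v0.
have vn : enorm v != 0 by apply: contra_neq v0; exact: enorm_eq0.
pose e := (enorm v)^-1 *: v.
have ee : e^T *m e = 1%:M.
  apply/matrixP => i j; rewrite !ord1 [RHS]mxE eqxx -/(dotv e e) -enorm_sq.
  by rewrite enormZ ger0_norm ?invr_ge0 ?enorm_ge0 // mulVf // expr1n.
have Ze : Z^T *m e = 0 by rewrite -scalemxAr Zv scaler0.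
have : `[< onf (d + 1)%N >].
  apply/asboolP; exists (row_mx Z e); split; last first.
    by rewrite mul_mx_row MZ -scalemxAr Mv scaler0 row_mx0.
  rewrite tr_row_mx mul_col_row ZZ Ze ee.
  by rewrite -[e^T *m Z]trmxK trmx_mul trmxK Ze trmx0 -scalar_mx_block.
by move/dmax; rewrite addn1 ltnn.
Qed.

Lemma exists_ker m n (M : 'M[R]_(m, n)) : (m < n)%N ->
  exists2 w : 'cV[R]_n, w != 0 & M *m w = 0.
Proof.
move=> mn; have : kermx M^T != 0.
  rewrite -mxrank_eq0 mxrank_ker mxrank_tr -lt0n subn_gt0.
  exact: leq_ltn_trans (rank_leq_row _) mn.
move=> /rowV0Pn [v /sub_kermxP vM v0].
exists v^T; first by rewrite trmx_eq0.
by apply: trmx_inj; rewrite trmx_mul trmxK vM trmx0.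
Qed.

(** The least-norm solution [G^T (G G^T)^-1 c] of a surjective system is
    orthogonal to the kernel and is controlled by the coercivity of [G^T]. *)
Lemma least_norm_split m n (G : 'M[R]_(m, n)) (g : R) (c : 'cV[R]_m) :
  0 < g -> (forall l : 'cV[R]_m, g * enorm l ^+ 2 <= enorm (G^T *m l) ^+ 2) ->
  exists v : 'cV[R]_n, [/\ G *m v = c, g * enorm v ^+ 2 <= enorm c ^+ 2
    & forall w : 'cV[R]_n, G *m w = 0 -> dotv v w = 0].
Proof.
move=> g0 Gg.
have Ginj (l : 'cV[R]_m) : G^T *m l = 0 -> l = 0.
  move=> Gl; apply/enorm_eq0/eqP; rewrite -sqrf_eq0 eq_le sqr_ge0 andbT.
  by have := Gg l; rewrite Gl enorm0 expr0n /= pmulr_rle0.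
have inv : G *m G^T \in unitmx.
  apply: invertible_inj => l Gl; apply/Ginj/enorm_eq0/eqP.
  by rewrite -sqrf_eq0 enorm_sq dotv_mull trmxK mulmxA Gl dotv0r.
pose l := invmx (G *m G^T) *m c.
have Gl : G *m (G^T *m l) = c by rewrite mulmxA /l mulmxA mulmxV // mul1mx.
exists (G^T *m l); split=> // [|w Gw]; last by rewrite dotv_mull trmxK Gw dotv0r.
have vE : enorm (G^T *m l) ^+ 2 = dotv l c by rewrite enorm_sq dotv_mull trmxK Gl.
have h1 := Gg l; have h2 := cauchy_schwarz l c.
have l0 := enorm_ge0 l; have c0 := enorm_ge0 c.
rewrite vE in h1 *.
have [->|lp] := eqVneq l 0; first by rewrite dotv0l mulr0 sqr_ge0.
have {}lp : 0 < enorm l by rewrite lt_def l0 andbT; apply: contra_neq lp; exact: enorm_eq0.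
have h3 : g * enorm l <= enorm c.
  by rewrite -(ler_pM2r lp) mulrAC -mulrA [leRHS]mulrC -expr2; lra.
apply: le_trans (ler_wpM2l (ltW g0) h2) _.
by rewrite mulrA expr2 ler_wpM2r.
Qed.

Lemma young_cross (x y e : R) : 0 < e -> 2 * (x * y) <= e * x ^+ 2 + y ^+ 2 / e.
Proof.
move=> e0; have h := sqr_ge0 (e * x - y).
rewrite -(ler_pM2l e0).
have -> : e * (e * x ^+ 2 + y ^+ 2 / e) = e ^+ 2 * x ^+ 2 + y ^+ 2.
  by field; rewrite gt_eqF.
by move: h; lra.
Qed.

(** Here [a], [c], [d], [u], [v] are the norms of the two gradients, of the
    primal direction and of its kernel and least-norm parts. Everything is
    measured in [X = c^2 / (e2 g)], of which [e1 c^2] supplies 17. Bounding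
    [2 c^T dl] with weight 3/10 uses 40/3 of them. The quadratic form in
    [(a, U d)] that remains next to [- 53/100 e2 a^2] is at most
    [41/4 e2 (U d)^2], that is 41/48 of the curvature [gR d^2]. The other 7/48
    handle the cross term [2 U u v], and the terms in [v^2] cost less than
    3 [X], since [v^2 <= 4 e2 X] and [12 e2 U^2 <= gR]. *)
Lemma descent_scalar (a c d u v U gR g e1 e2 : R) :
  0 <= a -> 0 <= c -> 0 <= d -> 0 <= u -> 0 <= v ->
  1 < U -> 0 < gR -> gR <= U -> 0 < g -> g <= 1 / 4 -> 0 < e2 ->
  17 <= e1 * (e2 * g) -> e2 * (12 * U ^+ 2) <= gR ->
  d ^+ 2 = u ^+ 2 + v ^+ 2 -> g / 4 * v ^+ 2 <= c ^+ 2 ->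
  - (gR * u ^+ 2) + 2 * U * (u * v) + U * v ^+ 2
  + (3 / 10 * e2 * (a + U * d) ^+ 2 + c ^+ 2 * (40 / 3) / (e2 * g))
  - e1 * c ^+ 2 - e2 * a ^+ 2 + 2 * e2 * U * (a * d)
  <= - (53 / 100 * e2 * (a ^+ 2 + c ^+ 2)).
Proof.
move=> a0 c0 d0 u0 v0 U1 gR0 gRU g0 g4 e20 he1 he2 dE hv.
have U0 : 0 < U by apply: lt_trans U1.
pose X := c ^+ 2 / (e2 * g).
have eg0 : 0 < e2 * g by rewrite mulr_gt0.
have X0 : 0 <= X by rewrite divr_ge0 ?sqr_ge0 // ltW.
have cX : c ^+ 2 = e2 * g * X by rewrite /X; field; rewrite !gt_eqF.
have e1X : 17 * X <= e1 * c ^+ 2.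
  by rewrite cX mulrA ler_wpM2r.
have -> : c ^+ 2 * (40 / 3) / (e2 * g) = 40 / 3 * X.
  by rewrite /X; field; rewrite !gt_eqF.
pose q := U ^+ 2 / gR.
have qE : U ^+ 2 = q * gR by rewrite /q; field; rewrite gt_eqF.
have q0 : 0 < q by rewrite divr_gt0 // exprn_gt0.
have Uq : U <= q by rewrite /q ler_pdivlMr // expr2 ler_wpM2l // ltW.
have e2q : 12 * e2 * q <= 1.
  rewrite /q mulrA ler_pdivrMr // mul1r; apply: le_trans he2.
  by rewrite mulrA [12 * e2]mulrC.
(* With [q = U^2 / gR], every term in [v^2] is a multiple of [q v^2]. *)
have v2X : v ^+ 2 <= 4 * e2 * X.
  have : g / 4 * v ^+ 2 <= g / 4 * (4 * e2 * X).
    by apply: le_trans hv _; rewrite cX; lra.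
  by rewrite ler_pM2l // divr_gt0.
have qv : q * v ^+ 2 <= X / 3.
  apply: le_trans (ler_wpM2l (ltW q0) v2X) _.
  have := ler_wpM2r X0 e2q; lra.
have v20 := sqr_ge0 v.
have Uv : U * v ^+ 2 <= q * v ^+ 2 by rewrite ler_wpM2r.
have gRv : gR * v ^+ 2 <= q * v ^+ 2.
  by apply: le_trans Uv; rewrite ler_wpM2r.
have cross : 2 * U * (u * v) <= 7 / 48 * (gR * u ^+ 2) + 48 / 7 * (q * v ^+ 2).
  have e0 : 0 < 7 / 48 * gR by lra.
  have := young_cross u (U * v) e0.
  have -> : (U * v) ^+ 2 / (7 / 48 * gR) = 48 / 7 * (q * v ^+ 2).
    by rewrite /q; field; rewrite gt_eqF.
  by lra.
(* The coefficient 130/17 = 2.6 / (2 * 0.17) completes the square in [a]; the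
   resulting coefficient of [(U d)^2], 0.3 + 1.69 / 0.17, is below 41/4. *)
have quad : 3 / 10 * e2 * (a + U * d) ^+ 2 - e2 * a ^+ 2 + 2 * e2 * U * (a * d)
    + 53 / 100 * e2 * a ^+ 2 <= 41 / 4 * (e2 * U ^+ 2 * d ^+ 2).
  have := sqr_ge0 (a - 130 / 17 * (U * d)).
  have sUd := sqr_ge0 (U * d).
  move=> sq.
  have {}sq := mulr_ge0 (ltW e20) sq.
  have {}sUd := mulr_ge0 (ltW e20) sUd.
  by lra.
have he2' : 41 / 4 * (e2 * U ^+ 2 * d ^+ 2) <= 41 / 48 * (gR * d ^+ 2).
  by have := ler_wpM2r (sqr_ge0 d) he2; lra.
have small : 53 / 100 * e2 * c ^+ 2 <= 1 / 10 * X.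
  have e2s : e2 <= 1 / 12.
    have U2 : U <= U ^+ 2 by rewrite expr2 ler_peMl // ltW.
    have h : e2 * (12 * U ^+ 2) <= U ^+ 2 by apply: le_trans he2 _; apply: le_trans U2.
    have U20 : 0 < U ^+ 2 by rewrite exprn_gt0.
    rewrite -(ler_pM2r U20); lra.
  rewrite cX; have h1 : e2 * g <= 1 / 48.
    by have := ler_pM (ltW e20) (ltW g0) e2s g4; lra.
  have h2 : e2 * (e2 * g) <= 1 / 12 * (1 / 48).
    by apply: ler_pM => //; exact: ltW.
  have := ler_wpM2r X0 h2; lra.
rewrite dE in he2'.
by rewrite dE in quad; lra.
Qed.

Section Descent.
Variables (n m : nat) (Hh H : 'M[R]_n) (G : 'M[R]_(m, n)).
Variables (a dz : 'cV[R]_n) (c dl : 'cV[R]_m) (U gR g e1 e2 : R).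
Hypotheses (U1 : 1 < U) (gR0 : 0 < gR) (g0 : 0 < g) (g4 : g <= 1 / 4).
Hypotheses (e20 : 0 < e2) (he1 : 17 <= e1 * (e2 * g)) (he2 : e2 * (12 * U ^+ 2) <= gR).
Hypothesis gRU : gR <= U.
Hypothesis HU : forall v, enorm (H *m v) <= U * enorm v.
Hypothesis GU : forall v, enorm (G *m v) <= U * enorm v.

Lemma descent_exact :
  (forall v, enorm (Hh *m v) <= U * enorm v) ->
  (forall w, G *m w = 0 -> gR * enorm w ^+ 2 <= dotv w (Hh *m w)) ->
  (forall l, g / 4 * enorm l ^+ 2 <= enorm (G^T *m l) ^+ 2) ->
  Hh *m dz + G^T *m dl = - a -> G *m dz = - c ->
  dotv a dz + e1 * dotv c (G *m dz) + e2 * dotv a (H *m dz)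
   + (dotv c dl + e2 * dotv a (G^T *m dl))
  <= - (53 / 100 * e2 * (enorm a ^+ 2 + enorm c ^+ 2)).
Proof.
move=> HhU red coer newt1 newt2.
have [v [Gv vc vperp]] := @least_norm_split _ _ G (g / 4) (- c) (divr_gt0 g0 (ltr0Sn R 3)) coer.
rewrite enormN in vc.
pose u := dz - v.
have Gu : G *m u = 0 by rewrite /u mulmxBr newt2 Gv subrr.
have dzE : dz = u + v by rewrite /u subrK.
clearbody u.
have uv : dotv v u = 0 by exact: vperp.
have d2 : enorm dz ^+ 2 = enorm u ^+ 2 + enorm v ^+ 2.
  by rewrite !enorm_sq dzE dotvDl !dotvDr (dotvC u v) uv; lra.
have := @descent_scalar (enorm a) (enorm c) (enorm dz) (enorm u) (enorm v) U gR g e1 e2.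
rewrite !enorm_ge0 => /(_ isT isT isT isT isT U1 gR0 gRU g0 g4 e20 he1 he2 d2 vc).
apply: le_trans.
have GT : G^T *m dl = - a - Hh *m dz by rewrite -newt1 addrC addrA addNr add0r.
have adz : dotv a dz = - dotv dz (Hh *m dz) + dotv c dl.
  have -> : a = - (Hh *m dz) - G^T *m dl by rewrite -opprD newt1 opprK.
  rewrite dotvBl dotvNl (dotvC (Hh *m dz)) dotv_mull trmxK newt2 dotvNr opprK.
  by rewrite (dotvC dl).
have h1 : - dotv dz (Hh *m dz) <= - (gR * enorm u ^+ 2)
    + 2 * U * (enorm u * enorm v) + U * enorm v ^+ 2.
  have r := red u Gu.
  have Hb x y : - dotv x (Hh *m y) <= U * (enorm x * enorm y).
    have := cauchy_schwarz_abs x (Hh *m y).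
    rewrite ler_norml => /andP[h _]; rewrite lerNl; apply: le_trans h; rewrite lerN2.
    by rewrite mulrCA ler_wpM2l ?enorm_ge0.
  have := Hb u v; have := Hb v u; have := Hb v v.
  rewrite dzE mulmxDr dotvDl !dotvDr; lra.
have h2 : 2 * dotv c dl <= 3 / 10 * e2 * (enorm a + U * enorm dz) ^+ 2 +
    enorm c ^+ 2 * (40 / 3) / (e2 * g).
  have e0 : 0 < 3 / 40 * (e2 * g) by rewrite mulr_gt0 ?mulr_gt0 //; lra.
  have cs := cauchy_schwarz c dl.
  have yc := young_cross (enorm dl) (enorm c) e0.
  have -> : enorm c ^+ 2 * (40 / 3) / (e2 * g) = enorm c ^+ 2 / (3 / 40 * (e2 * g)).
    by field; rewrite !gt_eqF.
  have dlb : g / 4 * enorm dl ^+ 2 <= (enorm a + U * enorm dz) ^+ 2.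
    apply: le_trans (coer dl) _; rewrite GT.
    have p0 : 0 <= enorm a + U * enorm dz.
      by rewrite addr_ge0 ?mulr_ge0 ?enorm_ge0 // ltW // (lt_trans _ U1).
    rewrite ler_sqr ?nnegrE ?enorm_ge0 //.
    by apply: le_trans (enormD _ _) _; rewrite !enormN lerD2l.
  have e3 : 0 <= 3 / 10 * e2 by rewrite mulr_ge0 ?(ltW e20) //; lra.
  have := ler_wpM2l e3 dlb; lra.
have h3 : dotv a (H *m dz) - dotv a (Hh *m dz) <= 2 * U * (enorm a * enorm dz).
  have k1 := cauchy_schwarz a (H *m dz).
  have k2 := cauchy_schwarz (- a) (Hh *m dz); rewrite dotvNl enormN in k2.
  have a0 := enorm_ge0 a.
  have := ler_wpM2l a0 (HU dz); have := ler_wpM2l a0 (HhU dz); lra.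
have := ler_wpM2l (ltW e20) h3.
rewrite adz newt2 GT dotvNr dotvBr dotvNr -!enorm_sq.
by lra.
Qed.

(** The hypotheses force [e1 >= 816], so the term with [e1] dominates the
    others, which are bounded crudely; the condition on [delta] then gives
    [e2 g / 9 <= e2 / 36] up to one percent. *)
Lemma descent_error (ez : 'cV[R]_n) (el : 'cV[R]_m) (delta : R) :
  0 < e1 -> 0 < delta -> delta * (9 * e1 * U ^+ 2) <= e2 * g ->
  enorm (col_mx ez el) <= delta * (U * enorm (col_mx a c)) ->
  dotv a ez + e1 * dotv c (G *m ez) + e2 * dotv a (H *m ez)
   + (dotv c el + e2 * dotv a (G^T *m el))
  <= 3 / 100 * e2 * (enorm a ^+ 2 + enorm c ^+ 2).
Proof.
move=> e10 dl0 hd he; rewrite -enorm_col_mx.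
set r := enorm (col_mx a c) in he *; set e := enorm (col_mx ez el) in he.
have U0 : 0 < U by apply: lt_trans U1.
have sub_le p k (x : 'cV[R]_p) (y : 'cV[R]_k) :
    enorm x <= enorm (col_mx x y) /\ enorm y <= enorm (col_mx x y).
  by split; rewrite -ler_sqr ?nnegrE ?enorm_ge0 // enorm_col_mx ?lerDl ?lerDr ?sqr_ge0.
have [ar cr] := sub_le _ _ a c; have [ze le] := sub_le _ _ ez el.
rewrite -/r in ar cr; rewrite -/e in ze le.
have r0 : 0 <= r by exact: enorm_ge0.
have e0 : 0 <= e by exact: enorm_ge0.
have cs k (x y : 'cV[R]_k) C : enorm x <= r -> enorm y <= C * e -> dotv x y <= C * (r * e).
  move=> xr ye; apply: le_trans (cauchy_schwarz _ _) _.
  by rewrite mulrCA; apply: ler_pM => //; exact: enorm_ge0.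
have k1 : dotv a ez <= r * e by rewrite -[leRHS]mul1r cs // mul1r.
have k2 : dotv c el <= r * e by rewrite -[leRHS]mul1r cs // mul1r.
have k3 : dotv c (G *m ez) <= U * (r * e).
  by apply: cs => //; apply: le_trans (GU _) _; rewrite ler_wpM2l // ltW.
have k4 : dotv a (H *m ez) <= U * (r * e).
  by apply: cs => //; apply: le_trans (HU _) _; rewrite ler_wpM2l // ltW.
have k5 : dotv a (G^T *m el) <= U * (r * e).
  rewrite dotv_mulr trmxK; apply: le_trans (cauchy_schwarz _ _) _.
  rewrite mulrA; apply: ler_pM => //; rewrite ?enorm_ge0 //.
  by apply: le_trans (GU _) _; rewrite ler_wpM2l // ltW.
have re0 : 0 <= r * e by rewrite mulr_ge0.
have U20 : 0 < U ^+ 2 by rewrite exprn_gt0.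
have e2U : e2 * U <= 1 / 12.
  rewrite -(ler_pM2r U0).
  have : e2 * (12 * U ^+ 2) <= U by apply: le_trans he2 gRU.
  lra.
have e2s : e2 <= 1 / 12.
  by apply: le_trans e2U; rewrite ler_peMr // ltW.
have e1b : 816 <= e1.
  have h1 : e2 * g <= 1 / 48.
    by have := ler_pM (ltW e20) (ltW g0) e2s g4; lra.
  by have := ler_wpM2l (ltW e10) h1; move: he1; lra.
have e1U : e1 <= e1 * U by rewrite ler_peMr // ltW.
have S : dotv a ez + e1 * dotv c (G *m ez) + e2 * dotv a (H *m ez)
   + (dotv c el + e2 * dotv a (G^T *m el)) <= 101 / 100 * (e1 * U) * (r * e).
  have j3 := ler_wpM2l (ltW e10) k3.
  have j4 := ler_wpM2l (ltW e20) k4.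
  have j5 := ler_wpM2l (ltW e20) k5.
  have j6 := ler_wpM2r re0 e2U.
  have j7 : 816 * (r * e) <= e1 * U * (r * e) by rewrite ler_wpM2r //; lra.
  by lra.
apply: le_trans S _.
have e1U0 : 0 <= e1 * U by rewrite mulr_ge0 // ltW.
have j1 := ler_wpM2l r0 he.
have j2 := ler_wpM2l e1U0 j1.
have r20 := sqr_ge0 r.
have j3 := ler_wpM2r r20 hd.
have j4 : e2 * g * r ^+ 2 <= e2 * (1 / 4) * r ^+ 2.
  by rewrite ler_wpM2r // ler_wpM2l // ltW.
have j5 : 0 <= e2 * r ^+ 2 by rewrite mulr_ge0 // ltW.
by lra.
Qed.

End Descent.

(** A null vector of the KKT matrix has its primal part in the kernel of [G],
    with zero curvature, hence zero; its dual part is then in the kernel of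
    [G^T]. *)
Lemma kkt_unit n m (Hh : 'M[R]_n) (G : 'M[R]_(m, n)) (gR : R) :
  0 < gR ->
  (forall w, G *m w = 0 -> gR * enorm w ^+ 2 <= dotv w (Hh *m w)) ->
  (forall l : 'cV[R]_m, G^T *m l = 0 -> l = 0) ->
  block_mx Hh G^T G 0 \in unitmx.
Proof.
move=> gR0 red Ginj; apply: invertible_inj => v.
rewrite -[v]vsubmxK mul_block_col => /eqP; rewrite col_mx_eq0.
set x := usubmx v; set y := dsubmx v.
rewrite mul0mx addr0 => /andP[/eqP k1 /eqP k2].
have x0 : x = 0.
  apply/enorm_eq0/eqP; rewrite -sqrf_eq0 eq_le sqr_ge0 andbT.
  have := red x k2.
  have -> : Hh *m x = - (G^T *m y) by apply/eqP; rewrite -addr_eq0 k1.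
  by rewrite dotvNr dotv_mulr trmxK k2 dotv0l oppr0 pmulr_rle0.
by rewrite x0 (Ginj y) ?col_mx0 // -k1 x0 mulmx0 add0r.
Qed.

End Linear.

(** * Bounds from the problem data *)

Section Assembly.
Set Implicit Arguments.
Unset Strict Implicit.
Context {R : realType}.

(** The upper bound comes from the denominator [(1 + U)^(2t)] alone: the other
    factors are at most 1. *)
Lemma gammaG_bounds (gC U : R) t : 0 < gC -> 1 < U -> (0 < t)%N ->
  0 < gammaG gC U t /\ gammaG gC U t <= 1 / 4.
Proof.
move=> g0 U1 t0; have U0 : 0 < U by apply: lt_trans U1.
have Um1 : 0 < U - 1 by rewrite subr_gt0.
have d0 : 0 < gC + U ^+ t.+1 / (U - 1) by rewrite addr_gt0 ?divr_gt0 ?exprn_gt0.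
have m0 : 0 < Num.min 1 gC by rewrite lt_min ltr01.
have E0 : 0 < (1 + U) ^+ (2 * t) by rewrite exprn_gt0 // addr_gt0.
have f1 : (gC / (gC + U ^+ t.+1 / (U - 1))) ^+ 2 <= 1.
  have x0 : 0 <= gC / (gC + U ^+ t.+1 / (U - 1)) by rewrite divr_ge0 ?ltW.
  rewrite expr_le1 // ler_pdivrMr // mul1r lerDl.
  by rewrite divr_ge0 ?exprn_ge0 // ltW.
rewrite /gammaG; split; first by rewrite !mulr_gt0 ?exprn_gt0 ?divr_gt0 // invr_gt0.
have f2 : Num.min 1 gC / (1 + U) ^+ (2 * t) <= 1 / 4.
  have E4 : 4 <= (1 + U) ^+ (2 * t).
    have E2 : 2 <= (1 + U) ^+ t.
      rewrite -(prednK t0) exprS.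
      have := exp1U_ge1 U1 t.-1; have := U1; nra.
    by rewrite mulnC exprM expr2; nra.
  rewrite ler_pdivrMr //.
  have : Num.min 1 gC <= 1 by rewrite ge_min lexx.
  lra.
have f20 : 0 <= Num.min 1 gC / (1 + U) ^+ (2 * t) by rewrite divr_ge0 ?ltW.
by rewrite -[leRHS]mul1r ler_pM ?sqr_ge0.
Qed.

Context {N nx nu : nat}.
Variable P : ocp R N nx nu.

Lemma enorm_hhat_le (U : R) Hh HhN (z v : 'cV[R]_(zdim N nx nu)) :
  0 <= U -> upper_bounded P U Hh HhN z ->
  enorm (hhat_mx Hh HhN *m v) <= U * enorm v.
Proof.
move=> U0 [up upN].
apply: le_enorm; first by rewrite mulr_ge0 ?enorm_ge0.
rewrite exprMn enorm_sq -[v]vsubmxK /hhat_mx mul_block_col !mul0mx addr0 add0r.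
rewrite !dotv_col_mx mulrDr lerD //; last first.
  by rewrite -!enorm_sq -exprMn ler_sqr ?nnegrE ?mulr_ge0 ?enorm_ge0 // enorm_mul_le.
set w := usubmx v; rewrite -[w]submxcolK mul_mxdiag_mxcol !dotv_mxcol mulr_sumr.
apply: ler_sum => k _; rewrite !mxcolK -!enorm_sq -exprMn.
rewrite ler_sqr ?nnegrE ?mulr_ge0 ?enorm_ge0 // enorm_mul_le //.
by have [] := up k.
Qed.

(** The hypothesis quantifies over orthonormal bases of the kernel, so it says
    something about kernel vectors only because such a basis exists. *)
Lemma reduced_hessian_ker gR Hh HhN (z w : 'cV[R]_(zdim N nx nu)) :
  reduced_hessian P gR Hh HhN z -> Gmx P z *m w = 0 ->
  gR * enorm w ^+ 2 <= dotv w (hhat_mx Hh HhN *m w).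
Proof.
move=> red Gw; have [d [Z onZ]] := exists_onb_ker (Gmx P z).
have [_ h] := red d Z onZ; have [ZZ kZ] := onZ.
have [y wE] := (kZ w).1 Gw; have := h y.
rewrite -mulmxA -/(dotv y _) mulmxBl dotvBr mul_scalar_mx dotvZr subr_ge0.
rewrite -!mulmxA (dotv_mulr Z^T) trmxK -wE => h'; apply: le_trans h'.
by rewrite enorm_sq wE dotv_mull mulmxA ZZ mul1mx.
Qed.

(** Hence the Jacobian has a nonzero kernel vector, on which the reduced Hessian
    bound can be compared with the bound on the blocks. *)
Lemma ldim_lt_zdim : (0 < N)%N -> (0 < nu)%N -> (ldim N nx < zdim N nx nu)%N.
Proof.
by move=> N0 nu0; rewrite /ldim /zdim !sum_nat_const !card_ord; nia.
Qed.

End Assembly.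

Theorem theorem5p1 (R : realType) (N nx nu : nat)
  (N_gt0 : (0 < N)%N) (nx_gt0 : (0 < nx)%N) (nu_gt0 : (0 < nu)%N)
  (P : ocp R N nx nu)
  (* iterates, step sizes, modified Hessian blocks, exact and approximate
     Newton directions *)
  (z : nat -> 'cV[R]_(zdim N nx nu)) (l : nat -> 'cV[R]_(ldim N nx))
  (alpha : nat -> R)
  (Hh : nat -> 'I_N -> 'M[R]_(nx + nu)) (HhN : nat -> 'M[R]_nx)
  (dz tdz : nat -> 'cV[R]_(zdim N nx nu)) (dl tdl : nat -> 'cV[R]_(ldim N nx))
  (Zs : 'I_N -> set 'cV[R]_(nx + nu)) (ZN : set 'cV[R]_nx)
  (Ls : 'I_N.+1 -> set 'cV[R]_nx)
  (gRH gC Uupper UHG UKKT eta1 eta2 delta : R) (t : nat)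
  (Hh_sym : forall tau k, (Hh tau k)^T = Hh tau k)
  (HhN_sym : forall tau, (HhN tau)^T = HhN tau)
  (newton : forall tau,
     kkt_mx P (Hh tau) (HhN tau) (z tau) *m col_mx (dz tau) (dl tau)
     = - kkt_residual P (z tau) (l tau))
  (z_next : forall tau, z tau.+1 = z tau + alpha tau *: tdz tau)
  (l_next : forall tau, l tau.+1 = l tau + alpha tau *: tdl tau)
  (gRH_gt0 : 0 < gRH)
  (red_hess : forall tau, reduced_hessian P gRH (Hh tau) (HhN tau) (z tau))
  (gC_gt0 : 0 < gC) (t_gt0 : (0 < t)%N)
  (ctrl : forall tau, controllable P gC t (z tau))
  (Uupper_gt1 : 1 < Uupper)
  (upper : forall tau, upper_bounded P Uupper (Hh tau) (HhN tau) (z tau))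
  (smooth : thrice_cont_diff P)
  (box_compact : compact (primal_box Zs ZN `*` dual_box Ls))
  (in_box : forall tau a, 0 <= a <= 1 ->
     (primal_box Zs ZN `*` dual_box Ls)
       (z tau + a *: tdz tau, l tau + a *: tdl tau))
  (box_upper : box_bounded P Uupper Zs ZN Ls)
  (UHG_gt0 : 0 < UHG)
  (UHG_H : forall y m, primal_box Zs ZN y -> dual_box Ls m ->
     opnorm (Hmx P y m) <= UHG)
  (UHG_G : forall y, primal_box Zs ZN y -> opnorm (Gmx P y) <= UHG)
  (UKKT_gt0 : 0 < UKKT)
  (UKKT_inv : forall tau,
     opnorm (invmx (kkt_mx P (Hh tau) (HhN tau) (z tau))) <= UKKT)
  (delta_in : 0 < delta < 1)
  (approx : forall tau,
     enorm (col_mx (tdz tau - dz tau) (tdl tau - dl tau))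
     <= delta * enorm (col_mx (dz tau) (dl tau)))
  (eta1_gt0 : 0 < eta1) (eta2_gt0 : 0 < eta2) :
  let U := Num.max Uupper (Num.max UKKT UHG) in
  let gG := gammaG gC Uupper t in
  eta1 >= 17 / (eta2 * gG) ->
  eta2 <= gRH / (12 * U ^+ 2) ->
  delta <= eta2 * gG / (9 * eta1 * U ^+ 2) ->
  forall tau,
    ((merit_grad P eta1 eta2 (z tau) (l tau))^T *m col_mx (tdz tau) (tdl tau)) 0 0
    <= - (eta2 / 2) * enorm (kkt_residual P (z tau) (l tau)) ^+ 2.
Proof.
move=> U gG he1 he2 hd tau.
have [gG0 gG4] := gammaG_bounds gC_gt0 Uupper_gt1 t_gt0.
rewrite -/gG in gG0 gG4.
have UuU : Uupper <= U by rewrite /U le_max lexx.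
have UkU : UKKT <= U by rewrite /U !le_max lexx orbT.
have UhU : UHG <= U by rewrite /U !le_max lexx !orbT.
have U1 : 1 < U by exact: lt_le_trans UuU.
have U0 : 0 < U by apply: lt_trans U1.
have Uu0 : 0 <= Uupper by apply: le_trans (ltW Uupper_gt1).
have wid (x y v : R) : y <= U -> x <= y * v -> 0 <= v -> x <= U * v.
  by move=> yU xy v0; apply: le_trans xy _; rewrite ler_wpM2r.
have zbox : primal_box Zs ZN (z tau) /\ dual_box Ls (l tau).
  by have /= := in_box tau 0; rewrite lexx ler01 !scale0r !addr0 => /(_ isT).
set G := Gmx P (z tau); set H := Hmx P (z tau) (l tau).
set Hhat := hhat_mx (Hh tau) (HhN tau).
set a := grad_z P (z tau) (l tau); set c := constr P (z tau).
have HU v : enorm (H *m v) <= U * enorm v.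
  apply: (wid _ UHG) => //; last exact: enorm_ge0.
  by apply: enorm_mul_le; case: zbox; exact: UHG_H.
have GU v : enorm (G *m v) <= U * enorm v.
  apply: (wid _ UHG) => //; last exact: enorm_ge0.
  by apply: enorm_mul_le; case: zbox => zb _; exact: UHG_G.
have HhU' v : enorm (Hhat *m v) <= Uupper * enorm v.
  exact: enorm_hhat_le (upper tau).
have HhU v : enorm (Hhat *m v) <= U * enorm v.
  by apply: (wid _ Uupper) => //; exact: enorm_ge0.
have red w : G *m w = 0 -> gRH * enorm w ^+ 2 <= dotv w (Hhat *m w).
  exact: reduced_hessian_ker (red_hess tau).
have coer m : gG / 4 * enorm m ^+ 2 <= enorm (G^T *m m) ^+ 2.
  exact: (Gmx_coercive smooth _ gC_gt0 Uupper_gt1 (ctrl tau) (upper tau)).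
(* Test the reduced Hessian on a nonzero kernel vector. *)
have gRHU : gRH <= U.
  have [w w0 Gw] := exists_ker G (ldim_lt_zdim N_gt0 nu_gt0).
  have wp : 0 < enorm w by rewrite lt_def enorm_ge0 andbT; apply: contra_neq w0; exact: enorm_eq0.
  have wp2 : 0 < enorm w ^+ 2 by rewrite exprn_gt0.
  rewrite -(ler_pM2r wp2); apply: le_trans (red w Gw) _.
  apply: le_trans (cauchy_schwarz _ _) _.
  by rewrite expr2 mulrCA ler_wpM2l ?enorm_ge0.
have eg0 : 0 < eta2 * gG by rewrite mulr_gt0.
have U20 : 0 < U ^+ 2 by rewrite exprn_gt0.
have he1' : 17 <= eta1 * (eta2 * gG) by rewrite -ler_pdivrMr.
have he2' : eta2 * (12 * U ^+ 2) <= gRH by rewrite -ler_pdivlMr // mulr_gt0.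
have hd' : delta * (9 * eta1 * U ^+ 2) <= eta2 * gG.
  by rewrite -ler_pdivlMr // !mulr_gt0.
have resE : kkt_residual P (z tau) (l tau) = col_mx a c.
  by rewrite /kkt_residual grad_lE.
have := newton tau; rewrite /kkt_mx -/Hhat -/G mul_block_col mul0mx addr0 resE.
rewrite opp_col_mx => /eq_col_mx [newt1 newt2].
have dirU : enorm (col_mx (dz tau) (dl tau)) <= U * enorm (col_mx a c).
  have inv : kkt_mx P (Hh tau) (HhN tau) (z tau) \in unitmx.
    by apply: (kkt_unit gRH_gt0 red) => m; exact: Gmx_trmul_inj.
  have -> : col_mx (dz tau) (dl tau) =
      invmx (kkt_mx P (Hh tau) (HhN tau) (z tau)) *m - col_mx a c.
    by rewrite -resE -newton mulmxA mulVmx // mul1mx.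
  apply: (wid _ UKKT) => //; last exact: enorm_ge0.
  by rewrite -[X in _ * X]enormN; exact: enorm_mul_le.
have /andP[delta0 _] := delta_in.
have errU : enorm (col_mx (tdz tau - dz tau) (tdl tau - dl tau)) <=
    delta * (U * enorm (col_mx a c)).
  by apply: le_trans (approx tau) _; rewrite ler_wpM2l // ltW.
have exact := descent_exact U1 gRH_gt0 gG0 gG4 eta2_gt0 he1' he2' gRHU HU HhU red coer newt1 newt2.
have error := descent_error U1 gG0 gG4 eta2_gt0 he1' he2' gRHU HU GU eta1_gt0 delta0 hd' errU.
rewrite -/(dotv _ _) /merit_grad dotv_col_mx derive_merit_z // derive_merit_l //.
rewrite -/a -/c -/G -/H enorm_col_mx.
have tz : tdz tau = dz tau + (tdz tau - dz tau) by rewrite subrKC.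
have tl : tdl tau = dl tau + (tdl tau - dl tau) by rewrite subrKC.
move: tz tl error; move: (tdz tau - dz tau) (tdl tau - dl tau) => ez el -> -> error.
rewrite !mulmxDr !dotvDr; move: exact error; lra.
Qed.
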